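(* There exists an algorithm which, given $\ell\in\mathbb{N}$ and a set $A\subset\{\mathtt 0,\mathtt 1\}^\ell$ not containing $\mathtt 0^\ell$, performs $2^{O(\ell)}$ operations and decides whether the corresponding pattern counting sequence $a_A$ is noncorrelated.
   Context: For a word $v$ over $\{\mathtt 0,\mathtt 1\}$ not of the form $\mathtt 0^j$ and $n\in\mathbb{N}_0$, $\#(v,n)$ is the number of pairs of words $(x,y)$ with $\mathtt 0^{|v|-1}(n)_2=xvy$, where $(n)_2$ is the binary expansion of $n$ without leading zeros (occurrences counted with overlaps). For such $A$, $a_A(n)=(-1)^{\sum_{v\in A}\#(v,n)}$. For $a\colon\mathbb{N}_0\to\mathbb{C}$ and $m\in\mathbb{N}_0$, $\gamma_a(m)=\lim_{N\to\infty}\frac1N\sum_{n=0}^{N-1}a(n)\overline{a(n+m)}$; $a$ is noncorrelated if $\gamma_a(m)$ exists and equals $0$ for every $m\geq 1$. The implied constant in $O(\ell)$ is absolute. *)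

(* Defs.v *)
From HB Require Import structures.
From mathcomp Require Import all_boot all_order all_algebra.
From mathcomp Require Import all_classical all_reals all_analysis.
From mathcomp Require Import complex.

Set Implicit Arguments.
Unset Strict Implicit.
Unset Printing Implicit Defensive.

Import Order.TTheory GRing.Theory Num.Theory.
Import numFieldNormedType.Exports.

Local Open Scope ring_scope.

(* Letters are booleans and the most significant digit comes first. *)

Definition word := seq bool.

(* [up_log 2 n.+1] is the least k with n < 2 ^ k, i.e. the number of binary
   digits of n; in particular (0)_2 is the empty word. *)
Definition binary_expansion (n : nat) : word :=
  rev (mkseq (fun i => odd (n %/ 2 ^ i)) (up_log 2 n.+1)).

Definition padded_expansion (k n : nat) : word :=
  nseq k false ++ binary_expansion n.

(* The number of pairs (x, y) with w = x v y: such x and y are never longer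
   than w, so they range over the finite type of words of length <= |w|. *)
Definition factorizations (v w : word) : nat :=
  #|[set p : (size w).-bseq bool * (size w).-bseq bool
      | w == p.1 ++ v ++ p.2]|.

Definition occurrences (v : word) (n : nat) : nat :=
  factorizations v (padded_expansion (size v).-1 n).

Definition pattern_seq (R : realType) (l : nat) (A : {set l.-tuple bool})
    (n : nat) : R[i] :=
  (-1) ^+ (\sum_(v in A) occurrences v n)%N.

(* Stated over a [numClosedFieldType] because the topology of the norm is
   inferred there and not for R[i]; to be used with C := R[i]. *)

Section Correlation.
Variable C : numClosedFieldType.
Implicit Types a : nat -> C.

Definition correlation_average a (m N : nat) : C :=
  N%:R^-1 * \sum_(0 <= n < N) a n * Num.conj (a (n + m)%N).

Definition correlation a (m : nat) : C := limn (correlation_average a m).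

Definition noncorrelated a : Prop :=
  forall m : nat, (1 <= m)%N ->
    cvgn (correlation_average a m) /\ correlation a m = 0.

End Correlation.

(* The model is the random access machine of Cook and Reckhow with unit cost,
   with structured control flow.  The only arithmetic is addition and
   truncated subtraction of natural numbers, so that one operation lengthens
   the numbers in use by at most one bit: running times agree with those of
   Turing machines up to a polynomial, and the notion of a running time
   2 ^ O(l) is the same in both models. *)

Definition reg := nat.

Inductive program : Type :=
| Skip
| Const of reg & nat              (* x := c *)
| Plus of reg & reg & reg         (* x := y + z *)
| Minus of reg & reg & reg        (* x := y - z *)
| Fetch of reg & reg              (* x := cells[y] *)
| Store of reg & reg              (* cells[x] := y *)
| Seq of program & program
| If of reg & program & program   (* tests x != 0 *)
| While of reg & program.         (* tests x != 0 *)

Record state := State { regs : reg -> nat; cells : nat -> nat }.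

Definition update (f : nat -> nat) (x c : nat) : nat -> nat :=
  fun y => if y == x then c else f y.

Definition set_reg (s : state) (x : reg) (c : nat) : state :=
  State (update (regs s) x c) (cells s).

Definition set_cell (s : state) (k c : nat) : state :=
  State (regs s) (update (cells s) k c).

(* [exec p s t s']: started in s, the program p halts in s' after exactly t
   operations; each elementary instruction and each test is one operation. *)
Inductive exec : program -> state -> nat -> state -> Prop :=
| ExecSkip s : exec Skip s 1 s
| ExecConst s x c : exec (Const x c) s 1 (set_reg s x c)
| ExecPlus s x y z :
    exec (Plus x y z) s 1 (set_reg s x (regs s y + regs s z)%N)
| ExecMinus s x y z :
    exec (Minus x y z) s 1 (set_reg s x (regs s y - regs s z)%N)
| ExecFetch s x y : exec (Fetch x y) s 1 (set_reg s x (cells s (regs s y)))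
| ExecStore s x y : exec (Store x y) s 1 (set_cell s (regs s x) (regs s y))
| ExecSeq p q s t s1 u s2 :
    exec p s t s1 -> exec q s1 u s2 -> exec (Seq p q) s (t + u)%N s2
| ExecIfT x p q s t s1 :
    regs s x <> 0%N -> exec p s t s1 -> exec (If x p q) s t.+1 s1
| ExecIfF x p q s t s1 :
    regs s x = 0%N -> exec q s t s1 -> exec (If x p q) s t.+1 s1
| ExecWhileT x p s t s1 u s2 :
    regs s x <> 0%N -> exec p s t s1 -> exec (While x p) s1 u s2 ->
    exec (While x p) s (t + u).+1 s2
| ExecWhileF x p s :
    regs s x = 0%N -> exec (While x p) s 1 s.

Lemma exec_deterministic p s t s1 u s2 :
  exec p s t s1 -> exec p s u s2 -> t = u /\ s1 = s2.
Proof.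
move=> E; elim: E u s2 => {p s t s1}; try by move=> *;
  match goal with H : exec _ _ _ _ |- _ => inversion H; subst end.
- move=> p q s t s1 u s2 _ IHp _ IHq v s3 E; inversion E; subst.
  by have [? ?] := IHp _ _ ltac:(eassumption); subst;
     have [? ?] := IHq _ _ ltac:(eassumption); subst.
- move=> x p q s t s1 nz _ IH v s3 E; inversion E; subst => //.
  by have [? ?] := IH _ _ ltac:(eassumption); subst.
- move=> x p q s t s1 z _ IH v s3 E; inversion E; subst => //.
  by have [? ?] := IH _ _ ltac:(eassumption); subst.
- move=> x p s t s1 u s2 nz _ IHp _ IHw v s3 E; inversion E; subst => //.
  by have [? ?] := IHp _ _ ltac:(eassumption); subst;
     have [? ?] := IHw _ _ ltac:(eassumption); subst.
Qed.

Definition word_value (w : word) : nat :=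
  foldl (fun k (b : bool) => (k.*2 + b)%N) 0%N w.

(* Register 0 holds l, the memory cells 0, ..., 2 ^ l - 1 hold the
   characteristic function of A (words being ordered by their value), and
   everything else is 0. *)
Definition input_state (l : nat) (A : {set l.-tuple bool}) : state :=
  State (fun x => if x == 0%N then l else 0%N)
        (fun k => nat_of_bool [exists v in A, word_value v == k]).

(* The answer is read off register 0: 1 for "yes" and 0 for "no". *)
Definition answers (s : state) (P : Prop) : Prop :=
  (P /\ regs s 0%N = 1%N) \/ (~ P /\ regs s 0%N = 0%N).

(* Main.v *)
(** Let k = l - 1, K = 2 ^ k, let a be the pattern counting sequence and
    f_m(n) = a(n) a(n + m).  Deleting the last digit d of n changes a by a sign
    depending on n mod 2 K only, and turns the shift m into (m + d) %/ 2.  Hence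
    the vectors of sums of f_m over the residue classes mod K satisfy a linear
    recursion in the length of the range of n, and for m <= 2 ^ j and
    N >= 2 k + j the sums H_N(m) of f_m over [2 ^ N, 2 ^ (N + 2)) double exactly
    when N increases.  On the other hand f_m is, up to a bounded number of terms
    coming from long carries, the same on all blocks of length 2 ^ N.  So a is
    noncorrelated iff for every j the integer
      S_j = sum over 0 < m <= 2 ^ j of H_(2 k + j)(m) ^ 2
    vanishes.  Expanding the squares, S_j = u B^j y for a matrix B of size
    4 K ^ 3, so that by Cayley-Hamilton only j < 4 K ^ 3 matter.  Finally
    0 <= S_j < 2 ^ (16 K ^ 3), so S_j = 0 as soon as all q <= 16 K ^ 3 + 1 divide
    it: the program iterates B modulo each of these q, with numbers of O(l)
    bits. *)

Require Import Defs.
From mathcomp Require Import all_boot all_order all_algebra.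
From mathcomp Require Import all_classical all_reals all_analysis.
From mathcomp Require Import complex.
From mathcomp Require Import zify ring lra.

Set Implicit Arguments.
Unset Strict Implicit.
Unset Printing Implicit Defensive.

Import Order.TTheory GRing.Theory Num.Theory.
Import numFieldNormedType.Exports.

(** * A small language and its compilation *)

(** Tracking H_(2 k + j)(m) for every m <= 2 ^ j would need a table that grows with j. Sums of
    squares give a recursion of fixed size instead: a product of two correlations with a common
    shift is followed through the residues mod K of M, n1, n2 and two carries c1, c2, the shifts
    being M + c1 and M + c2. The carries must be separate because the digits deleted from n1 and n2
    differ; this gives 4 K ^ 3 states.

    The ends of the blocks have ratio 4 rather than 2 because of shift 1: its carry survives along
    trailing ones and yields an eigenvalue that may be -1, which only two steps of the recursion
    cancel.

    Small moduli keep negative values and long integers out of the machine. Testing all q instead of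
    primes only replaces estimates on primes by an elementary lower bound for common multiples.
    Division and multiplication are replaced by conditional subtraction and by a table of multiples
    of K. *)

(* Variables are immutable and numbered from the outside in; all mutation goes
   through the memory. *)
Inductive expr :=
| Var of nat
| Cst of nat
| Add of expr & expr
| Sub of expr & expr
| Get of expr
| Cond of expr & expr & expr.

Inductive cmd :=
| Write of expr & expr
| Then of cmd & cmd
| Let of expr & cmd
| For of expr & cmd.

Fixpoint eval (e : expr) (env : seq nat) (m : nat -> nat) : nat :=
  match e with
  | Var i => nth 0 env i
  | Cst c => c
  | Add e1 e2 => eval e1 env m + eval e2 env m
  | Sub e1 e2 => eval e1 env m - eval e2 env m
  | Get e1 => m (eval e1 env m)
  | Cond e1 e2 e3 => if eval e1 env m != 0 then eval e2 env m else eval e3 env m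
  end.

Fixpoint repeat (f : nat -> (nat -> nat) -> nat -> nat) (n : nat)
    (m : nat -> nat) : nat -> nat :=
  if n is n'.+1 then f n' (repeat f n' m) else m.

Fixpoint sem (c : cmd) (env : seq nat) (m : nat -> nat) : nat -> nat :=
  match c with
  | Write e1 e2 => update m (eval e1 env m) (eval e2 env m)
  | Then c1 c2 => sem c2 env (sem c1 env m)
  | Let e c1 => sem c1 (rcons env (eval e env m)) m
  | For e c1 => repeat (fun i => sem c1 (rcons env i)) (eval e env m) m
  end.

(** Only an upper bound: [Cond] pays for both branches, which makes the cost independent of the
    memory. A variable costs 2 because copying a register takes a [Const] and a [Plus]. *)
Fixpoint ecost (e : expr) : nat :=
  match e with
  | Var _ => 2
  | Cst _ => 1
  | Add e1 e2 | Sub e1 e2 => ecost e1 + ecost e2 + 1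
  | Get e1 => ecost e1 + 1
  | Cond e1 e2 e3 => ecost e1 + ecost e2 + ecost e3 + 1
  end.

(** The 4 pays for the test and the three instructions that update the two loop registers; the 2 in
    [cost] pays for initialising the index and for the last test. *)
Fixpoint repeat_cost (cost : nat -> (nat -> nat) -> nat)
    (f : nat -> (nat -> nat) -> nat -> nat) (n : nat) (m : nat -> nat) : nat :=
  if n is n'.+1
  then repeat_cost cost f n' m + (cost n' (repeat f n' m) + 4) else 0.

Fixpoint cost (c : cmd) (env : seq nat) (m : nat -> nat) : nat :=
  match c with
  | Write e1 e2 => ecost e1 + ecost e2 + 1
  | Then c1 c2 => cost c1 env m + cost c2 env (sem c1 env m)
  | Let e c1 => ecost e + cost c1 (rcons env (eval e env m)) m
  | For e c1 =>
      ecost e + repeat_cost (fun i => cost c1 (rcons env i))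
        (fun i => sem c1 (rcons env i)) (eval e env m) m + 2
  end.

(* Variable [i] lives in register [2 i] and register [2 i + 1] holds the number
   of iterations left when it is a loop index; the expression compiled at [d]
   leaves its value in register [d] and uses only registers above as scratch. *)
Fixpoint compile_expr (n : nat) (e : expr) (d : reg) : program :=
  match e with
  | Var i => if i < n then Seq (Const d 0) (Plus d d i.*2) else Const d 0
  | Cst c => Const d c
  | Add e1 e2 =>
      Seq (compile_expr n e1 d) (Seq (compile_expr n e2 d.+1) (Plus d d d.+1))
  | Sub e1 e2 =>
      Seq (compile_expr n e1 d) (Seq (compile_expr n e2 d.+1) (Minus d d d.+1))
  | Get e1 => Seq (compile_expr n e1 d) (Fetch d d)
  | Cond e1 e2 e3 =>
      Seq (compile_expr n e1 d)
          (If d (compile_expr n e2 d) (compile_expr n e3 d))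
  end.

Fixpoint compile (n : nat) (c : cmd) : program :=
  let d := n.*2 in
  match c with
  | Write e1 e2 =>
      Seq (compile_expr n e1 d) (Seq (compile_expr n e2 d.+1) (Store d d.+1))
  | Then c1 c2 => Seq (compile n c1) (compile n c2)
  | Let e c1 => Seq (compile_expr n e d) (compile n.+1 c1)
  | For e c1 =>
      Seq (compile_expr n e d.+1) (Seq (Const d 0)
        (While d.+1
          (Seq (compile n.+1 c1) (Seq (Const d.+2 1)
            (Seq (Plus d d d.+2) (Minus d.+1 d.+1 d.+2))))))
  end.

Definition agree (d : reg) (s s' : state) : Prop :=
  forall x, x < d -> regs s' x = regs s x.

Definition holds (env : seq nat) (s : state) : Prop :=
  forall i, i < size env -> regs s i.*2 = nth 0 env i.

Lemma agree_trans d s1 s2 s3 : agree d s1 s2 -> agree d s2 s3 -> agree d s1 s3.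
Proof. by move=> h1 h2 x xd; rewrite h2 ?h1. Qed.

Lemma agree_le d d' s1 s2 : d' <= d -> agree d s1 s2 -> agree d' s1 s2.
Proof. by move=> dd h x xd; apply: h; apply: leq_trans dd. Qed.

Lemma agree_set d x c s : d <= x -> agree d s (set_reg s x c).
Proof.
move=> dx y yd; rewrite /set_reg /update /=; case: eqP => // yx.
by move: yd; rewrite yx ltnNge dx.
Qed.

Lemma holds_agree env s s' :
  holds env s -> agree (size env).*2 s s' -> holds env s'.
Proof. by move=> h a i ilt; rewrite a ?h // ltn_double. Qed.

(** The clause [agree d] keeps the variables intact and lets a binary operation evaluate its second
    operand at [d.+1] without losing the first. *)
Lemma compile_exprP env e d s :
  holds env s -> (size env).*2 <= d ->
  exists t s', [/\ exec (compile_expr (size env) e d) s t s', t <= ecost e,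
    agree d s s', cells s' = cells s & regs s' d = eval e env (cells s)].
Proof.
elim: e d s => [i|c|e1 IH1 e2 IH2|e1 IH1 e2 IH2|e1 IH1|e1 IH1 e2 IH2 e3 IH3]
  d s hs hd /=.
- case: ifP => hi.
    exists 2, (set_reg (set_reg s d 0) d (0 + regs s i.*2)); split=> //.
    + have := ExecPlus (set_reg s d 0) d d i.*2.
      rewrite /= /update eqxx ifN; first exact: ExecSeq (ExecConst _ _ _).
      by rewrite neq_ltn (leq_trans _ hd) // ltn_double.
    + by apply: (@agree_trans _ _ (set_reg s d 0)); apply: agree_set.
    + by rewrite /= /update eqxx add0n hs.
  exists 1, (set_reg s d 0); split=> //; [exact: ExecConst|exact: agree_set|].
  by rewrite /= /update eqxx nth_default // leqNgt hi.
- exists 1, (set_reg s d c); split=> //; [exact: ExecConst|exact: agree_set|].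
  by rewrite /= /update eqxx.
- have [t1 [s1 [x1 l1 a1 c1 r1]]] := IH1 d s hs hd.
  have hs1 : holds env s1 by apply: holds_agree hs (agree_le hd a1).
  have [t2 [s2 [x2 l2 a2 c2 r2]]] := IH2 d.+1 s1 hs1 (leqW hd).
  exists (t1 + (t2 + 1)), (set_reg s2 d (regs s2 d + regs s2 d.+1)); split=> //.
  + by apply: ExecSeq x1 _; apply: ExecSeq x2 _; apply: ExecPlus.
  + by rewrite addnA leq_add2r leq_add.
  + apply: agree_trans a1 _; apply: agree_trans (agree_le (leqnSn _) a2) _.
    exact: agree_set.
  + by rewrite /= c2.
  + by rewrite /= /update eqxx r2 a2 // r1 c1.
- have [t1 [s1 [x1 l1 a1 c1 r1]]] := IH1 d s hs hd.
  have hs1 : holds env s1 by apply: holds_agree hs (agree_le hd a1).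
  have [t2 [s2 [x2 l2 a2 c2 r2]]] := IH2 d.+1 s1 hs1 (leqW hd).
  exists (t1 + (t2 + 1)), (set_reg s2 d (regs s2 d - regs s2 d.+1)); split=> //.
  + by apply: ExecSeq x1 _; apply: ExecSeq x2 _; apply: ExecMinus.
  + by rewrite addnA leq_add2r leq_add.
  + apply: agree_trans a1 _; apply: agree_trans (agree_le (leqnSn _) a2) _.
    exact: agree_set.
  + by rewrite /= c2.
  + by rewrite /= /update eqxx r2 a2 // r1 c1.
- have [t1 [s1 [x1 l1 a1 c1 r1]]] := IH1 d s hs hd.
  exists (t1 + 1), (set_reg s1 d (cells s1 (regs s1 d))); split=> //.
  + by apply: ExecSeq x1 _; apply: ExecFetch.
  + by rewrite leq_add2r.
  + by apply: agree_trans a1 _; apply: agree_set.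
  + by rewrite /= /update eqxx r1 c1.
- have [t1 [s1 [x1 l1 a1 c1 r1]]] := IH1 d s hs hd.
  have hs1 : holds env s1 by apply: holds_agree hs (agree_le hd a1).
  case: eqP => nz /=.
    have [t2 [s2 [x2 l2 a2 c2 r2]]] := IH3 d s1 hs1 hd.
    exists (t1 + t2.+1), s2; split=> //.
    + by apply: ExecSeq x1 _; apply: ExecIfF x2; rewrite r1.
    + by lia.
    + exact: agree_trans a2.
    + by rewrite c2.
    + by rewrite r2 c1.
  have [t2 [s2 [x2 l2 a2 c2 r2]]] := IH2 d s1 hs1 hd.
  exists (t1 + t2.+1), s2; split=> //.
  + by apply: ExecSeq x1 _; apply: ExecIfT x2; rewrite r1.
  + by lia.
  + exact: agree_trans a2.
  + by rewrite c2.
  + by rewrite r2 c1.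
Qed.

Lemma holds_rcons env v s :
  holds env s -> regs s (size env).*2 = v -> holds (rcons env v) s.
Proof.
move=> h hv i; rewrite size_rcons nth_rcons ltnS leq_eqVlt.
by case/predU1P=> [->|lt]; [rewrite ltnn eqxx|rewrite lt h].
Qed.

Lemma compileP c env s :
  holds env s ->
  exists t s', [/\ exec (compile (size env) c) s t s',
    t <= cost c env (cells s), agree (size env).*2 s s' &
    cells s' = sem c env (cells s)].
Proof.
elim: c env s => [e1 e2|c1 IH1 c2 IH2|e c IH|e c IH] env s hs /=.
- have [t1 [s1 [x1 l1 a1 c1 r1]]] := compile_exprP e1 hs (leqnn _).
  have hs1 := holds_agree hs a1.
  have [t2 [s2 [x2 l2 a2 c2 r2]]] := compile_exprP e2 hs1 (leqnSn _).
  exists (t1 + (t2 + 1)),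
    (set_cell s2 (regs s2 (size env).*2) (regs s2 (size env).*2.+1)); split.
  + by apply: ExecSeq x1 _; apply: ExecSeq x2 _; apply: ExecStore.
  + by lia.
  + exact: agree_trans a1 (agree_le (leqnSn _) a2).
  + by rewrite /= c2 r2 a2 // r1 c1.
- have [t1 [s1 [x1 l1 a1 m1]]] := IH1 _ _ hs.
  have [t2 [s2 [x2 l2 a2 m2]]] := IH2 _ _ (holds_agree hs a1).
  exists (t1 + t2), s2; split.
  + exact: ExecSeq x1 x2.
  + by rewrite leq_add // -m1.
  + exact: agree_trans a2.
  + by rewrite m2 m1.
- have [t1 [s1 [x1 l1 a1 c1 r1]]] := compile_exprP e hs (leqnn _).
  have hs1 := holds_rcons (holds_agree hs a1) r1.
  have [t2 [s2 [x2 l2 a2 m2]]] := IH _ _ hs1.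
  rewrite c1 in l2 m2; rewrite size_rcons in x2 a2.
  exists (t1 + t2), s2; split=> //.
  + exact: ExecSeq x1 x2.
  + exact: leq_add.
  + by apply: agree_trans a1 _; apply: agree_le a2; rewrite leq_double.
- set d := (size env).*2.
  have [t1 [s1 [x1 l1 a1 c1 r1]]] := compile_exprP e hs (leqnSn d).
  set n := eval e env (cells s) in r1 *.
  pose body := Seq (compile (size env).+1 c) (Seq (Const d.+2 1)
            (Seq (Plus d d d.+2) (Minus d.+1 d.+1 d.+2))).
  pose f i := sem c (rcons env i); pose g i := cost c (rcons env i).
  (* Invariant: i iterations are done and k remain. The time still to be spent is measured against
     the rest of [repeat_cost], the extra 1 being the final test. *)
  have loop k : forall i s2, holds env s2 -> regs s2 d = i ->
      regs s2 d.+1 = k -> i + k = n -> cells s2 = repeat f i (cells s) ->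
      exists t s', [/\ exec (While d.+1 body) s2 t s',
        repeat_cost g f i (cells s) + t <= repeat_cost g f n (cells s) + 1,
        agree d s2 s' & cells s' = repeat f n (cells s)].
    elim: k => [|k IHk] i s2 hs2 hi hk hn hc.
      exists 1, s2; split=> //; first exact: ExecWhileF.
        by rewrite -hn addn0 leq_add2l.
      by rewrite -hn addn0.
    have hs2' := holds_rcons hs2 hi.
    have [t2 [s3 [x2 l2 a2 m2]]] := IH _ _ hs2'.
    rewrite size_rcons doubleS in x2 a2.
    pose s4 := set_reg s3 d.+2 1.
    pose s5 := set_reg s4 d (regs s4 d + regs s4 d.+2).
    pose s6 := set_reg s5 d.+1 (regs s5 d.+1 - regs s5 d.+2).
    have a6 : agree d s2 s6.
      apply: (@agree_trans _ _ s3); first by apply: agree_le a2; lia.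
      apply: (@agree_trans _ _ s4); first by apply: agree_set; lia.
      apply: (@agree_trans _ _ s5); first by apply: agree_set; lia.
      by apply: agree_set; lia.
    have [|||||t [s' [x' l' a' m']]] := IHk i.+1 s6.
    + exact: holds_agree hs2 a6.
    + by rewrite /= /update /= !eqxx ifN ?ifN ?a2 ?hi; lia.
    + rewrite /= /update /= !eqxx ifN; last by lia.
      by rewrite ifN ?ifN ?ifN ?a2 ?hk; lia.
    + by lia.
    + by rewrite /= m2 hc.
    exists ((t2 + (1 + (1 + 1))) + t).+1, s'; split=> //.
    + apply: ExecWhileT x'; first by rewrite hk.
      apply: ExecSeq x2 _; apply: (@ExecSeq _ _ _ _ s4); first exact: ExecConst.
      by apply: (@ExecSeq _ _ _ _ s5); [exact: ExecPlus|exact: ExecMinus].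
    + by move: l' l2; rewrite /= hc -/(g i); lia.
    + exact: agree_trans a'.
  pose s2 := set_reg s1 d 0.
  have a2 : agree d s s2.
    by apply: agree_trans (agree_le _ a1) _; [lia|apply: agree_set].
  have [|||||t [s' [x' l' a' m']]] := loop n 0 s2.
  + exact: holds_agree hs a2.
  + by rewrite /= /update eqxx.
  + by rewrite /= /update ifN ?r1; lia.
  + by [].
  + by rewrite /= c1.
  exists (t1 + (1 + t)), s'; split=> //.
  + apply: ExecSeq x1 _; apply: (@ExecSeq _ _ _ _ s2) x'; exact: ExecConst.
  + by move: l' l1; rewrite /f /g /=; lia.
  + exact: agree_trans a'.
Qed.

(* A bound [2 ^ (x * l)] for the cost, given bounds of the same form for the
   variables; loop bounds must not depend on the memory. *)
Fixpoint ebound (e : expr) (xs : seq nat) : option nat :=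
  match e with
  | Var i => Some (nth 0 xs i)
  | Cst c => Some c
  | Add e1 e2 =>
      if (ebound e1 xs, ebound e2 xs) is (Some x, Some y)
      then Some (x + y + 1) else None
  | _ => None
  end.

(** [Let] is refused: the powers of K that [decide] binds with it are read from the memory, and
    [decideP] bounds them by hand. *)
Fixpoint cbound (c : cmd) (xs : seq nat) : option nat :=
  match c with
  | Write e1 e2 => Some (ecost e1 + ecost e2 + 1)
  | Then c1 c2 =>
      if (cbound c1 xs, cbound c2 xs) is (Some x, Some y)
      then Some (x + y + 1) else None
  | Let _ _ => None
  | For e c1 =>
      if ebound e xs is Some x then
        if cbound c1 (rcons xs x) is Some y
        then Some (x + y + ecost e + 8) else None
      else None
  end.

Definition bounded (l : nat) (env xs : seq nat) : Prop :=
  forall i, nth 0 env i <= 2 ^ (nth 0 xs i * l).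

Lemma leq_pow2M l c : 0 < l -> c <= 2 ^ (c * l).
Proof.
move=> l0; apply: leq_trans (ltnW (ltn_expl c (ltnSn 1))) _.
by rewrite leq_exp2l // leq_pmulr.
Qed.

Lemma leq_pow2D l a b x y : 0 < l ->
  a <= 2 ^ (x * l) -> b <= 2 ^ (y * l) -> a + b <= 2 ^ ((x + y + 1) * l).
Proof.
move=> l0 ha hb; apply: leq_trans (leq_add ha hb) _.
rewrite !mulnDl mul1n !expnD -mulnA.
have h2 : 2 <= 2 ^ l by rewrite -{1}(expn1 2) leq_exp2l.
move: (2 ^ l) (2 ^ (x * l)) (2 ^ (y * l)) h2 (expn_gt0 2 (x * l))
  (expn_gt0 2 (y * l)) => c p q /= h2 p0 q0.
apply: (@leq_trans (p * (q * 2))); last by rewrite !leq_mul2l h2 !orbT.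
by nia.
Qed.

Lemma leq_pow2_mul l a b x y :
  a <= 2 ^ (x * l) -> b <= 2 ^ (y * l) -> a * b <= 2 ^ ((x + y) * l).
Proof. by move=> ha hb; rewrite mulnDl expnD leq_mul. Qed.

Lemma eboundP l e env xs m x : 0 < l -> bounded l env xs ->
  ebound e xs = Some x -> eval e env m <= 2 ^ (x * l).
Proof.
move=> l0 hb; elim: e x => //= [i|c|e1 IH1 e2 IH2] x.
- by case=> <-.
- by case=> <-; apply: leq_pow2M.
- case: (ebound e1 xs) IH1 => // y /(_ _ erefl) h1.
  case: (ebound e2 xs) IH2 => // z /(_ _ erefl) h2 [<-].
  exact: leq_pow2D.
Qed.

Lemma bounded_rcons l env xs v x : size env = size xs ->
  bounded l env xs -> v <= 2 ^ (x * l) ->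
  bounded l (rcons env v) (rcons xs x).
Proof.
move=> hsz hb hv i; rewrite !nth_rcons hsz.
by case: ifP => // _; case: ifP.
Qed.

Lemma cboundP l c env xs m x : 0 < l -> size env = size xs ->
  bounded l env xs -> cbound c xs = Some x -> cost c env m <= 2 ^ (x * l).
Proof.
move=> l0; elim: c env xs m x => //= [e1 e2|c1 IH1 c2 IH2|e c IH] env xs m x
  hsz hb.
- by case=> <-; apply: leq_pow2M.
- case E1: (cbound c1 xs) => [y|] //; case E2: (cbound c2 xs) => [z|] // [<-].
  by apply: leq_pow2D => //; [apply: IH1 E1|apply: IH2 E2].
- case E1: (ebound e xs) => [y|] //.
  case E2: (cbound c _) => [z|] // [<-].
  have hn := eboundP m l0 hb E1.
  set n := eval e env m in hn *.
  set f := fun i => sem _ _; set g := fun i => cost _ _.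
  have body k : k <= n -> repeat_cost g f k m <= k * 2 ^ ((z + 4 + 1) * l).
    elim: k => //= k IHk kn; rewrite mulSn addnC leq_add ?IHk //; last by lia.
    apply: leq_pow2D => //; last exact: leq_pow2M.
    apply: IH E2; first by rewrite !size_rcons hsz.
    by apply: bounded_rcons => //; lia.
  have h1 := leq_pow2_mul hn (leqnn (2 ^ ((z + 4 + 1) * l))).
  have h2 := leq_pow2M (ecost e + 2) l0.
  have := leq_pow2D l0 (leq_trans (body n (leqnn n)) h1) h2.
  have -> : y + (z + 4 + 1) + (ecost e + 2) + 1 = y + z + ecost e + 8 by lia.
  by lia.
Qed.

(** * The decision program *)

(** A single conditional subtraction; it gives the remainder mod q when the argument is below 2
    q. *)
Definition reduce (e q : expr) : expr := Cond (Sub q e) e (Sub e q).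
Definition xor (e1 e2 : expr) : expr := Cond e1 (Sub (Cst 1) e2) e2.
Definition twice (e : expr) : expr := Add e e.

(* The variables 2, 3 and 4 hold K = 2 ^ (l - 1), K ^ 2 and K ^ 3.  The memory
   contains the characteristic function of A on [0, 2 K), six parities of
   pattern counts, the multiples of K up to K ^ 3, two arrays of length 4 K ^ 3
   and two scalars. *)
Definition vK := Var 2.
Definition vX := Var 4.
Definition eL := twice vK.
Definition eT := Add eL (Cst 6).
Definition eO := Add (Add eT (Var 3)) (Cst 1).
Definition eX4 := twice (twice vX).
Definition eW := Add eO eX4.
Definition eS := Add eW eX4.
Definition eB := Add eS (Cst 1).
Definition eQ := Add (Var 5) (Cst 2).

Definition parity (e : expr) : expr := Get (Add eL e).
(** Table lookup in place of a multiplication; the arguments never exceed K ^ 2. *)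
Definition mulK (e : expr) : expr := Get (Add eT e).

Definition eidx (M c1 r1 c2 r2 : expr) : expr :=
  Add (Add (Add r2 (mulK (Add r1 (mulK M)))) (Cond c1 (twice vX) (Cst 0)))
      (Cond c2 vX (Cst 0)).

(** A true [bit] stands for the sign -1, realised by adding q - v. *)
Definition push (t bit v : expr) : cmd :=
  Write (Add eW t) (reduce (Add (Get (Add eW t)) (Cond bit (Sub eQ v) v)) eQ).

Definition flush : cmd :=
  For eX4 (Then (Write (Add eO (Var 7)) (Get (Add eW (Var 7))))
                (Write (Add eW (Var 7)) (Cst 0))).

Definition digit (b r : expr) : expr := Add (twice r) b.

Definition ebit (M r e c b : expr) : expr :=
  xor (Get (digit b r))
      (Get (reduce (Add (digit b r) (Add (digit e M) c)) eL)).

Definition ecarry (e c b : expr) : expr :=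
  Cond (Sub (Cst 2) (Add (Add e c) b)) (Cst 0) (Cst 1).

(* Appends the digits e, b1, b2 to M, n1, n2.  With E = 1 only e = 0 is allowed,
   so that M = 0 is kept. *)
Definition advance (E : nat) : cmd :=
  let M := Var 7 in let r1 := Var 8 in let r2 := Var 9 in
  let c1 := Var 10 in let c2 := Var 11 in
  let e := Var 12 in let b1 := Var 13 in let b2 := Var 14 in
  Then
    (For vK (For vK (For vK (For (Cst 2) (For (Cst 2)
      (For (Cst E) (For (Cst 2) (For (Cst 2)
        (push (eidx (reduce (digit e M) vK) c1 (reduce (digit b1 r1) vK) c2
                    (reduce (digit b2 r2) vK))
              (xor (ebit M r1 e c1 b1) (ebit M r2 e c2 b2))
              (Get (Add eO (eidx M (ecarry e c1 b1) r1 (ecarry e c2 b2)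
                                 r2))))))))))))
    flush.

(** Only the entries with both carries equal to 1 are summed: for them the shift M + 1 runs through
    1, ..., 2 ^ j. *)
Definition check : cmd :=
  Then (Write eS (Cst 0))
  (Then
    (For vK (For vK (For vK
      (Write eS (reduce (Add (Get eS)
         (Get (Add eO (eidx (Var 7) (Cst 1) (Var 8) (Cst 1) (Var 9))))) eQ)))))
    (Write eB (Cond (Get eS) (Cst 1) (Get eB)))).

(** The loop with one iteration only pads the environment, since [flush] expects its index to be
    variable 7. Three reductions are needed because the arguments reach 3 and K may be 1. *)
Definition start : cmd :=
  let n1 := Add (Var 7) (Cst 1) in let n2 := Add (Var 8) (Cst 1) in
  let c1 := Var 9 in let c2 := Var 10 in
  let res e := reduce (reduce (reduce e vK) vK) vK in
  For (Cst 1) (Then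
    (For (Cst 3) (For (Cst 3) (For (Cst 2) (For (Cst 2)
      (push (eidx (Cst 0) c1 (res n1) c2 (res n2))
            (xor (xor (parity n1) (parity (Add n1 c1)))
                 (xor (parity n2) (parity (Add n2 c2))))
            (Cst 1))))))
    flush).

Definition parities : cmd :=
  let x := digit (Var 6) (Var 5) in
  For (Cst 3) (For (Cst 2)
    (Write (Add eL x)
           (xor (parity (Var 5)) (Get (reduce (reduce x eL) eL))))).

Definition main : cmd :=
  Then parities
  (Then
    (For (twice (twice eX4))
      (Then start
      (Then (For (twice (Var 1)) (advance 1))
            (For eX4 (Then check (advance 2))))))
    (Write (Cst 0) (Sub (Cst 1) (Get eB)))).

(** Used in two rounds: the entries up to index K provide K ^ 2, the bound of the second round,
    whose last entry is K ^ 3. The argument [i] is the number of variables in scope, hence the name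
    of the loop index. *)
Definition multiples (n i : nat) : cmd :=
  let T := Add (twice vK) (Cst 6) in
  For (Var n) (Write (Add (Add T (Var i)) (Cst 1))
                     (Add (Get (Add T (Var i))) vK)).

Definition decide : cmd :=
  Let (Sub (Var 0) (Cst 1))
  (Then (Write (Cst 0) (Cst 1))
  (Then (For (Var 1) (Write (Cst 0) (twice (Get (Cst 0)))))
  (Let (Get (Cst 0))
  (Then (Write (Cst 0) (Cst 0))
  (Then (multiples 2 3)
  (Let (mulK vK)
  (Then (multiples 3 4)
  (Let (mulK (Var 3))
  main)))))))).

(** Variable 0 lives in register 0, where the input places l; at the end the answer is moved there
    from cell 0. *)
Definition decision_program : program :=
  Seq (compile 1 decide) (Seq (Const 1 0) (Fetch 0 1)).

(** * Correctness of the program *)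

(* In the sums over M, n1, n2 of
     a(n1) a(n1 + M + c1) a(n2) a(n2 + M + c2),
   the part where M, n1, n2 are congruent to M, r1, r2 mod K is stored at this
   index. *)
Definition idx (K M c1 r1 c2 r2 : nat) : nat :=
  r2 + K * (r1 + K * M) + c1 * (2 * K ^ 3) + c2 * K ^ 3.

Definition carry (e c b : nat) : nat := (e + c + b) %/ 2.

(** The parity contributed by the windows ending at the last digits of 2 n + b and of its translate
    by 2 M + e + c; it depends on n and M mod K only. *)
Definition window_bit (w : nat -> bool) (K M r e c b : nat) : bool :=
  w (r.*2 + b) (+) w ((r.*2 + b + (M.*2 + e + c)) %% K.*2).

Definition target (K M r1 r2 c1 c2 e b1 b2 : nat) : nat :=
  idx K ((M.*2 + e) %% K) c1 ((r1.*2 + b1) %% K) c2 ((r2.*2 + b2) %% K).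

Definition source (K M r1 r2 c1 c2 e b1 b2 : nat) : nat :=
  idx K M (carry e c1 b1) r1 (carry e c2 b2) r2.

Definition sign (b : bool) : int := (-1) ^+ b.

(** For E = 2 this is the action of B. For E = 1 the shift part M stays 0, which serves to reach
    blocks of length of order K ^ 2 before the shifts start to grow. *)
Definition push_weight (K E : nat) (w : nat -> bool) (Y : nat -> int)
    (t : nat) : int :=
  \sum_(0 <= M < K) \sum_(0 <= r1 < K) \sum_(0 <= r2 < K)
  \sum_(0 <= c1 < 2) \sum_(0 <= c2 < 2)
  \sum_(0 <= e < E) \sum_(0 <= b1 < 2) \sum_(0 <= b2 < 2)
    (if target K M r1 r2 c1 c2 e b1 b2 == t
     then sign (window_bit w K M r1 e c1 b1 (+) window_bit w K M r2 e c2 b2)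
          * Y (source K M r1 r2 c1 c2 e b1 b2)
     else 0)%R.

Definition start_weight (K : nat) (wa : nat -> bool) (t : nat) : int :=
  \sum_(0 <= n1 < 3) \sum_(0 <= n2 < 3) \sum_(0 <= c1 < 2) \sum_(0 <= c2 < 2)
    (if idx K 0 c1 (n1.+1 %% K) c2 (n2.+1 %% K) == t
     then sign (wa n1.+1 (+) wa (n1.+1 + c1) (+) (wa n2.+1 (+) wa (n2.+1 + c2)))
     else 0)%R.

Definition energy (K : nat) (Y : nat -> int) : int :=
  (\sum_(0 <= M < K) \sum_(0 <= r1 < K) \sum_(0 <= r2 < K)
    Y (idx K M 1 r1 1 r2))%R.

Definition residue (q : nat) (Y : int) (y : nat) : Prop :=
  (y < q) && (q %| (y%:Z - Y)%R)%Z.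

Definition reducen (q x : nat) : nat := if q - x != 0 then x else x - q.

Lemma reducenE q x : x < q.*2 -> reducen q x = x %% q.
Proof.
move=> h; rewrite /reducen subn_eq0 -ltnNge; case: ltnP => hx.
  by rewrite modn_small.
by rewrite -{2}(subnK hx) modnDr modn_small //; lia.
Qed.

Lemma reducen_lt q x : x < q.*2 -> reducen q x < q.
Proof. by move=> h; rewrite reducenE // ltn_mod; lia. Qed.

Lemma residue_reduce q Y x : x < q.*2 -> (q %| (x%:Z - Y)%R)%Z ->
  residue q Y (reducen q x).
Proof.
move=> h e; rewrite /residue reducen_lt //=.
move: e; rewrite {1}(divn_eq x q) -reducenE // PoszD PoszM -addrA.
by rewrite rpredDl // dvdz_mull.
Qed.

Lemma residue_trans q Y y Z y' :
  residue q Y y -> residue q (y%:Z + Z)%R y' -> residue q (Y + Z)%R y'.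
Proof.
move=> /andP[_ h] /andP[lt h']; rewrite /residue lt /=.
have -> : (y'%:Z - (Y + Z) = (y'%:Z - (y%:Z + Z)) + (y%:Z - Y))%R by ring.
exact: rpredD.
Qed.

Lemma residue_eq0 q Y y : residue q Y y -> (y == 0) = (q %| Y)%Z.
Proof.
case/andP=> lt h; apply/eqP/idP => [y0|hY].
  by move: h; rewrite y0 sub0r rpredN.
have : (q %| Posz y)%Z by rewrite -(subrK Y (Posz y)) rpredD.
by rewrite /dvdz /= => /dvdn_leq; case: y lt {h} => // y lt /(_ isT); lia.
Qed.

Lemma eval_Add e1 e2 env m :
  eval (Add e1 e2) env m = eval e1 env m + eval e2 env m.
Proof. by []. Qed.

Lemma eval_reduce e q env m :
  eval (reduce e q) env m = reducen (eval q env m) (eval e env m).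
Proof. by []. Qed.

Lemma eval_digit b r env m :
  eval (digit b r) env m = (eval r env m).*2 + eval b env m.
Proof. by rewrite /= addnn. Qed.

Lemma eval_xor e1 e2 env m (b1 b2 : bool) :
  eval e1 env m = b1 -> eval e2 env m = b2 ->
  eval (xor e1 e2) env m = (b1 (+) b2).
Proof. by move=> /= -> ->; case: b1 b2 => [] []. Qed.

Lemma eval_carry e c b env m :
  eval e env m < 2 -> eval c env m < 2 -> eval b env m < 2 ->
  eval (ecarry e c b) env m =
  carry (eval e env m) (eval c env m) (eval b env m).
Proof.
rewrite /= /carry; move: (eval e env m) (eval c env m) (eval b env m).
by move=> [|[|?]] [|[|?]] [|[|?]].
Qed.

Definition std (K : nat) (env : seq nat) : Prop :=
  [/\ nth 0 env 2 = K, nth 0 env 3 = K * K & nth 0 env 4 = K * K * K].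

Definition ofs_old (K : nat) := 2 * K + 6 + K ^ 2 + 1.
Definition ofs_new (K : nat) := ofs_old K + 4 * K ^ 3.
Definition ofs_acc (K : nat) := ofs_new K + 4 * K ^ 3.
Definition ofs_bad (K : nat) := (ofs_acc K).+1.

Lemma eval_offsets K env m : std K env ->
  [/\ eval eO env m = ofs_old K, eval eW env m = ofs_new K,
      eval eS env m = ofs_acc K, eval eB env m = ofs_bad K
    & eval eX4 env m = 4 * K ^ 3].
Proof.
case=> h2 h3 h4.
rewrite /= h2 h3 h4 /ofs_bad /ofs_acc /ofs_new /ofs_old !expnS expn0 !muln1 !mulnA.
by split; lia.
Qed.

Definition frame (K : nat) (w wa : nat -> bool) (m : nat -> nat) : Prop :=
  [/\ forall v, v < 2 * K -> m v = w v,
      forall x, x < 6 -> m (2 * K + x) = wa x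
    & forall x, x <= K ^ 2 -> m (2 * K + 6 + x) = K * x].

Lemma eval_mulK K w wa env m e : std K env -> frame K w wa m ->
  eval e env m <= K ^ 2 -> eval (mulK e) env m = K * eval e env m.
Proof.
case=> h2 _ _ [_ _ hT] le /=; rewrite h2 -hT //.
by congr m; lia.
Qed.

Lemma eval_idx K w wa env m M c1 r1 c2 r2 : std K env -> frame K w wa m ->
  eval M env m < K -> eval r1 env m < K ->
  eval c1 env m < 2 -> eval c2 env m < 2 ->
  eval (eidx M c1 r1 c2 r2) env m =
  idx K (eval M env m) (eval c1 env m) (eval r1 env m) (eval c2 env m)
    (eval r2 env m).
Proof.
move=> hs hf hM hr1 hc1 hc2; have [h2 h3 h4] := hs.
have e1 : eval (mulK M) env m = K * eval M env m.
  by rewrite (eval_mulK hs hf) // expnS expn1; nia.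
have e2 : eval (mulK (Add r1 (mulK M))) env m =
    K * (eval r1 env m + K * eval M env m).
  rewrite (eval_mulK hs hf) eval_Add e1 //.
  by rewrite expnS expn1; nia.
rewrite /idx -e2 /eidx.
rewrite 3!eval_Add [eval (Cond c2 _ _) _ _]/= [eval (Cond c1 _ _) _ _]/= h4.
have -> : K ^ 3 = K * K * K by rewrite !expnS expn0 muln1 mulnA.
congr (_ + _ + _).
  by move: (eval c1 env m) hc1 => [|[|?]] //= _; lia.
by move: (eval c2 env m) hc2 => [|[|?]] //= _; lia.
Qed.

Lemma idx_lt K M c1 r1 c2 r2 : M < K -> r1 < K -> r2 < K -> c1 < 2 -> c2 < 2 ->
  idx K M c1 r1 c2 r2 < 4 * K ^ 3.
Proof.
move=> hM h1 h2 hc1 hc2; rewrite /idx.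
have h : r1 + K * M < K ^ 2 by rewrite expnS expn1; nia.
have h' : r2 + K * (r1 + K * M) < K ^ 3 by rewrite [K ^ 3]expnS; nia.
move: h'; set x := _ + K * _; move: (K ^ 3) => X.
by case: c1 c2 hc1 hc2 => [|[|?]] [|[|?]] //; lia.
Qed.

Definition outside (base len x : nat) : bool := (x < base) || (base + len <= x).

(* Outside of [base, base + len) the memory is frozen to [m0]; inside, the
   command [F] adds [wt] modulo [q]. *)
Definition adds (base len q : nat) (m0 : nat -> nat)
    (F : (nat -> nat) -> nat -> nat) (wt : nat -> int) : Prop :=
  forall m, (forall x, outside base len x -> m x = m0 x) ->
    (forall t, t < len -> m (base + t) < q) ->
    (forall x, outside base len x -> F m x = m0 x) /\
    (forall t, t < len -> residue q ((m (base + t)%N)%:Z + wt t)%R (F m (base + t))).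

Lemma sem_For e c env m :
  sem (For e c) env m =
  repeat (fun i => sem c (rcons env i)) (eval e env m) m.
Proof. by []. Qed.

Lemma sem_Then c1 c2 env m : sem (Then c1 c2) env m = sem c2 env (sem c1 env m).
Proof. by []. Qed.

(** Every iteration sees the same frozen memory outside the array, so its contribution is known in
    advance and contributions add up. Nested loops thereby become nested sums. *)
Lemma adds_For base len q m0 e c env n (wt : nat -> nat -> int) :
  (forall m, eval e env m = n) ->
  (forall i, i < n -> adds base len q m0 (sem c (rcons env i)) (wt i)) ->
  adds base len q m0 (sem (For e c) env)
    (fun t => \sum_(0 <= i < n) wt i t)%R.
Proof.
move=> he hc m hm hq /=; rewrite he.
elim: n hc {he} => [|n IH] hc /=.
  split=> // t lt; rewrite big_geq // addr0 /residue hq //= subrr.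
  exact: rpred0.
have {IH} [|h1 h2] := IH; first by move=> i ilt; apply: hc; apply: ltnW.
have [h3 h4] := hc n (ltnSn n) _ h1 (fun t lt => proj1 (andP (h2 t lt))).
split=> // t lt; rewrite big_nat_recr //= addrA.
exact: residue_trans (h2 t lt) (h4 t lt).
Qed.

Lemma residue_sign q (b : bool) V v : 0 < q -> residue q V v ->
  (q %| ((if (b : nat) != 0 then q - v else v)%N%:Z - sign b * V)%R)%Z /\
  (if (b : nat) != 0 then q - v else v) <= q.
Proof.
move=> q0 /andP[lt h]; case: b => /=; last by rewrite mul1r (ltnW lt).
rewrite leq_subr; split=> //; rewrite -subzn 1?ltnW // mulN1r opprK.
have -> : (q%:Z - v%:Z + V = q%:Z - (v%:Z - V))%R by ring.
by rewrite rpredB.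
Qed.

Lemma adds_push K q m0 env t bit v t0 (b : bool) V :
  std K env -> nth 0 env 5 + 2 = q -> t0 < 4 * K ^ 3 ->
  (forall m, (forall x, outside (ofs_new K) (4 * K ^ 3) x -> m x = m0 x) ->
    [/\ eval t env m = t0, eval bit env m = b & residue q V (eval v env m)]) ->
  adds (ofs_new K) (4 * K ^ 3) q m0 (sem (push t bit v) env)
    (fun s => if t0 == s then sign b * V else 0)%R.
Proof.
move=> hs hq ht hm m h0 hlt; have [e1 e2 e3] := hm m h0.
have [_ hW _ _ _] := eval_offsets m hs.
have -> : sem (push t bit v) env m = update m (ofs_new K + t0)
    (reducen q (m (ofs_new K + t0) +
       if (b : nat) != 0 then q - eval v env m else eval v env m)).
  have hE : eval eQ env m = q by [].
  have hA : eval (Add eW t) env m = ofs_new K + t0 by rewrite eval_Add hW e1.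
  rewrite /push; move: (Add eW t) hA => f hA; rewrite /sem hA eval_reduce hE.
  by congr (update _ _ (reducen _ _)); rewrite eval_Add /= hA e2 -hE.
split=> [x hx|s hlts].
  rewrite /update; case: eqP => [ex|_]; last exact: h0.
  by move: hx; rewrite ex /outside; lia.
rewrite /update eqn_add2l [s == t0]eq_sym; have hv := hlt s hlts.
have q0 : 0 < q by lia.
case: eqP => [ets|_]; last first.
  by rewrite addr0 /residue hv subrr rpred0.
rewrite ets; case: (residue_sign b q0 e3).
set z := if _ then _ else _ => h1 h2; apply: residue_reduce; first by lia.
have -> : ((m (ofs_new K + s)%N + z)%:Z - ((m (ofs_new K + s)%N)%:Z + sign b * V)
  = z%:Z - sign b * V)%R by rewrite PoszD; ring.
by [].
Qed.

Definition represents (K : nat) (w wa : nat -> bool) (q : nat) (Y : nat -> int)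
    (bad : bool) (m : nat -> nat) : Prop :=
  [/\ frame K w wa m,
      forall t, t < 4 * K ^ 3 -> residue q (Y t) (m (ofs_old K + t)),
      forall t, t < 4 * K ^ 3 -> m (ofs_new K + t) = 0
    & m (ofs_bad K) = bad].

Lemma frame_eq K w wa m m' : (forall x, x < ofs_old K -> m' x = m x) ->
  frame K w wa m -> frame K w wa m'.
Proof.
rewrite /ofs_old => h [h1 h2 h3].
by split=> x hx; rewrite h; try lia; [exact: h1|exact: h2|exact: h3].
Qed.

Lemma outside_old K x : x < ofs_new K -> outside (ofs_new K) (4 * K ^ 3) x.
Proof. by rewrite /outside => ->. Qed.

Lemma outside_bad K : outside (ofs_new K) (4 * K ^ 3) (ofs_bad K).
Proof. by rewrite /outside /ofs_bad /ofs_acc leqnSn orbT. Qed.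

Lemma flushP K w wa q Y (bad : bool) env m : std K env -> size env = 7 ->
  frame K w wa m -> m (ofs_bad K) = bad ->
  (forall t, t < 4 * K ^ 3 -> residue q (Y t) (m (ofs_new K + t))) ->
  represents K w wa q Y bad (sem flush env m).
Proof.
move=> hs hz hf hb hY; have [_ _ _ _ hX] := eval_offsets m hs.
rewrite /flush sem_For hX.
set f := fun i => _.
have fE n m1 : f n m1 = update (update m1 (ofs_old K + n) (m1 (ofs_new K + n)))
    (ofs_new K + n) 0.
  have hs' : std K (rcons env n).
    by case: hs => *; split; rewrite nth_rcons hz.
  have hv m2 : eval (Var 7) (rcons env n) m2 = n.
    by rewrite /= nth_rcons hz ltnn eqxx.
  rewrite /f; set m2 := update m1 _ _.
  have [u1 u2 _ _ _] := eval_offsets m1 hs'.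
  have [_ u3 _ _ _] := eval_offsets m2 hs'.
  have -> : sem (Then (Write (Add eO (Var 7)) (Get (Add eW (Var 7))))
      (Write (Add eW (Var 7)) (Cst 0))) (rcons env n) m1 =
    update (update m1
      (eval eO (rcons env n) m1 + eval (Var 7) (rcons env n) m1)
      (m1 (eval eW (rcons env n) m1 + eval (Var 7) (rcons env n) m1)))
      (eval eW (rcons env n) (update m1
         (eval eO (rcons env n) m1 + eval (Var 7) (rcons env n) m1)
         (m1 (eval eW (rcons env n) m1 + eval (Var 7) (rcons env n) m1)))
       + eval (Var 7) (rcons env n) m1) 0 by [].
  by rewrite !hv u1 u2 -/m2 u3.
have inv n : n <= 4 * K ^ 3 ->
  [/\ forall x, x < ofs_old K -> repeat f n m x = m x,
   repeat f n m (ofs_bad K) = m (ofs_bad K),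
   forall t, t < n -> repeat f n m (ofs_old K + t) = m (ofs_new K + t) &
   forall t, t < 4 * K ^ 3 ->
     repeat f n m (ofs_new K + t) = if t < n then 0 else m (ofs_new K + t)].
  elim: n => [|n IH] hn; first by split.
  have [i1 i2 i3 i4] := IH (ltnW hn).
  rewrite [repeat f n.+1 m]/= fE; set m1 := repeat _ n m in i1 i2 i3 i4 *.
  rewrite /update; move: i1 i2 i3 i4; rewrite /ofs_bad /ofs_acc /ofs_new.
  move=> i1 i2 i3 i4; split.
  + by move=> x hx; rewrite !ifN ?i1 //; lia.
  + by rewrite !ifN ?i2 //; lia.
  + move=> t ht; rewrite ifN; last by lia.
    case: eqP => [e|ne]; last by rewrite i3 //; lia.
    by rewrite i4 // ltnn; congr m; lia.
  + move=> t ht; case: eqP => [e|ne]; first by rewrite ifT //; lia.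
    rewrite ifN ?i4 //; last by lia.
    by rewrite ltnS; case: ltngtP => // e; case: ne; rewrite e.
have [i1 i2 i3 i4] := inv _ (leqnn _); split.
- exact: frame_eq hf.
- by move=> t ht; rewrite i3 //; apply: hY.
- by move=> t ht; rewrite i4 // ht.
- by rewrite i2.
Qed.

Lemma eval_mod e q env m : eval e env m < (eval q env m).*2 ->
  eval (reduce e q) env m = eval e env m %% eval q env m.
Proof. exact: reducenE. Qed.

Lemma eval_ebit K w wa env m M r e c b : std K env -> frame K w wa m ->
  eval M env m < K -> eval r env m < K ->
  eval e env m < 2 -> eval c env m < 2 -> eval b env m < 2 ->
  eval (ebit M r e c b) env m =
  window_bit w K (eval M env m) (eval r env m) (eval e env m) (eval c env m)
    (eval b env m).
Proof.
move=> [h2 _ _] [hw _ _] hM hr he hc hb; apply: eval_xor.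
  rewrite -[LHS]/(m (eval (digit b r) env m)) eval_digit hw //.
  by rewrite mul2n; lia.
have hL : eval eL env m = K.*2 by rewrite eval_Add /= h2 addnn.
set x := reduce _ _; rewrite -[LHS]/(m (eval x env m)) /x eval_mod.
  rewrite hL eval_Add eval_digit eval_Add eval_digit hw //.
  by rewrite mul2n ltn_mod double_gt0; lia.
by rewrite hL eval_Add eval_digit eval_Add eval_digit; lia.
Qed.

Lemma advanceP K w wa q Y bad l k i j E m :
  let env := [:: l; k; K; K * K; K * K * K; i; j] in
  i + 2 = q -> E <= 2 -> represents K w wa q Y bad m ->
  represents K w wa q (push_weight K E w Y) bad (sem (advance E) env m).
Proof.
move=> env hq hE [hf hY hW hB]; rewrite /advance sem_Then.
set big := For vK _.
have H : adds (ofs_new K) (4 * K ^ 3) q m (sem big env) (push_weight K E w Y).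
  rewrite /big /push_weight; apply: adds_For => // M hM.
  apply: adds_For => // r1 hr1; apply: adds_For => // r2 hr2.
  apply: adds_For => // c1 hc1; apply: adds_For => // c2 hc2.
  apply: adds_For => // e he; apply: adds_For => // b1 hb1.
  apply: adds_For => // b2 hb2; apply: adds_push => //.
    by rewrite idx_lt // ltn_mod; lia.
  move=> m' hm'; rewrite [rcons _ _]/=; set env' := _ :: _.
  have hs' : std K env' by [].
  have hf' : frame K w wa m'.
    by apply: frame_eq hf => x hx; apply/hm'/outside_old/ltn_addr.
  have he2 : e < 2 by apply: leq_trans he hE.
  have carry2 c b : c < 2 -> b < 2 -> carry e c b < 2.
    by move=> hc hb; rewrite /carry ltn_divLR //; lia.
  have hmod a b : eval a env' m' < 2 -> eval b env' m' < K ->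
      eval (reduce (digit a b) vK) env' m' =
      ((eval b env' m').*2 + eval a env' m') %% K.
    move=> ha hb; rewrite eval_mod eval_digit //.
    by rewrite [eval vK _ _]/=; lia.
  split.
  - rewrite (eval_idx _ hs' hf') //.
    + by rewrite !hmod.
    + by rewrite hmod // ltn_mod; lia.
    + by rewrite hmod // ltn_mod; lia.
  - by apply: eval_xor; apply: (eval_ebit hs' hf').
  - have [u1 _ _ _ _] := eval_offsets m' hs'.
    set x := Add eO _; rewrite -[eval (Get x) _ _]/(m' (eval x env' m')) /x.
    have hx : source K M r1 r2 c1 c2 e b1 b2 < 4 * K ^ 3.
      by apply: idx_lt => //; apply: carry2.
    have -> : eval (Add eO (eidx (Var 7) (ecarry (Var 12) (Var 10) (Var 13))
        (Var 8) (ecarry (Var 12) (Var 11) (Var 14)) (Var 9))) env' m' =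
        ofs_old K + source K M r1 r2 c1 c2 e b1 b2.
      rewrite eval_Add u1 (eval_idx _ hs' hf') //.
      + by rewrite !eval_carry.
      + by rewrite eval_carry //; apply: carry2.
      + by rewrite eval_carry //; apply: carry2.
    rewrite hm'; first exact: hY.
    by apply: outside_old; rewrite /ofs_new; lia.
have q0 : 0 < q by lia.
have [||h1 h2] := H m; first by [].
  by move=> t ht; rewrite hW.
apply: flushP => //.
- by apply: frame_eq hf => x hx; apply/h1/outside_old/ltn_addr.
- by rewrite h1 //; apply: outside_bad.
- by move=> t ht; move: (h2 t ht); rewrite hW // add0r.
Qed.

(** The accumulator is treated as an array of length 1, so that [adds_For] applies to it as well. *)
Lemma checkP K w wa q Y (bad : bool) l k i j m :
  let env := [:: l; k; K; K * K; K * K * K; i; j] in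
  i + 2 = q -> represents K w wa q Y bad m ->
  represents K w wa q Y (bad || ~~ (q %| energy K Y)%Z) (sem check env m).
Proof.
move=> env hq [hf hY hW hB]; rewrite /check !sem_Then.
have q0 : 0 < q by lia.
have hs : std K env by [].
have [u1 u2 u3 u4 u5] := eval_offsets m hs.
have -> : sem (Write eS (Cst 0)) env m = update m (ofs_acc K) 0 by rewrite -u3.
set m1 := update _ _ _; set big := For vK _.
have fresh x m' : x < ofs_acc K ->
    (forall x, outside (ofs_acc K) 1 x -> m' x = m1 x) -> m' x = m x.
  move=> hx hm'; rewrite hm'; last by rewrite /outside hx.
  by rewrite /m1 /update ifN // neq_ltn hx.
have H : adds (ofs_acc K) 1 q m1 (sem big env)
    (fun t => if t == 0 then energy K Y else 0)%R.
  suff : adds (ofs_acc K) 1 q m1 (sem big env) (fun t => energy K Y).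
    move=> h m' hm' hlt; have [h1 h2] := h m' hm' hlt; split=> // t.
    by move=> ht; move: (h2 t ht); case: t ht.
  rewrite /energy; apply: adds_For => // M hM.
  apply: adds_For => // r1 hr1; apply: adds_For => // r2 hr2.
  move=> m' hm' hlt; rewrite [rcons _ _]/=; set env' := _ :: _.
  have hs' : std K env' by [].
  have [v1 v2 v3 v4 v5] := eval_offsets m' hs'.
  have hf' : frame K w wa m'.
    apply: frame_eq hf => x hx; apply: fresh => //.
    by rewrite /ofs_acc /ofs_new; lia.
  set x := idx K M 1 r1 1 r2.
  have hx : x < 4 * K ^ 3 by apply: idx_lt.
  have hxE : eval (Add eO (eidx (Var 7) (Cst 1) (Var 8) (Cst 1) (Var 9))) env' m'
      = ofs_old K + x by rewrite eval_Add v1 (eval_idx _ hs' hf').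
  set f := Add eO _ in hxE *.
  have -> : sem (Write eS (reduce (Add (Get eS) (Get f)) eQ)) env' m' =
      update m' (eval eS env' m') (reducen (eval eQ env' m')
        (m' (eval eS env' m') + m' (eval f env' m'))) by [].
  have -> : eval eQ env' m' = q by [].
  rewrite v3 hxE (fresh (ofs_old K + x)) //; last first.
    by rewrite /ofs_acc /ofs_new; lia.
  split.
    move=> y hy; rewrite /update ifN ?hm' //.
    by move: hy; rewrite /outside; lia.
  case=> // _; rewrite addn0 /update eqxx.
  have h0 := hlt 0 isT; rewrite addn0 in h0.
  have /andP[h1 h2] := hY x hx.
  apply: residue_reduce; first by lia.
  by rewrite PoszD opprD addrACA subrr add0r.
have [||h1 h2] := H m1; first by [].
  by case=> // _; rewrite addn0 /m1 /update eqxx.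
set m2 := sem big env m1 in h1 h2 *.
have hacc := residue_eq0 (h2 0 isT); rewrite eqxx addn0 in hacc.
have m1acc : m1 (ofs_acc K) = 0 by rewrite /m1 /update eqxx.
rewrite m1acc add0r in hacc.
have low x : x < ofs_acc K -> m2 x = m x.
  by move=> hx; apply: fresh.
have hb : m2 (ofs_bad K) = bad.
  rewrite h1; last by rewrite /outside /ofs_bad addn1 leqnn orbT.
  by rewrite /m1 /update ifN // /ofs_bad neq_ltn ltnSn orbT.
have [w1 w2 w3 w4 w5] := eval_offsets m2 hs.
have -> : sem (Write eB (Cond (Get eS) (Cst 1) (Get eB))) env m2 =
    update m2 (eval eB env m2) (if m2 (eval eS env m2) != 0 then 1
      else m2 (eval eB env m2)) by [].
rewrite w4 w3 hb hacc.
have upd x c : x < ofs_acc K -> update m2 (ofs_bad K) c x = m x.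
  by move=> hx; rewrite /update ifN ?low // neq_ltn /ofs_bad ltnW.
split.
- apply: frame_eq hf => x hx; apply: upd.
  by rewrite /ofs_acc /ofs_new; lia.
- by move=> t ht; rewrite upd; [exact: hY|rewrite /ofs_acc /ofs_new; lia].
- by move=> t ht; rewrite upd; [exact: hW|rewrite /ofs_acc /ofs_new; lia].
- by rewrite /update eqxx; case: (q %| _)%Z; case: (bad).
Qed.

Lemma repeat_ind (P : nat -> (nat -> nat) -> Prop) f n m : P 0 m ->
  (forall i m', i < n -> P i m' -> P i.+1 (f i m')) -> P n (repeat f n m).
Proof.
move=> h0; elim: n => //= n IH hS; apply: (hS) => //.
by apply: IH => i m' ilt; apply: hS; apply: ltnW.
Qed.

Lemma modn_reducen q x : reducen q x %% q = x %% q.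
Proof.
rewrite /reducen subn_eq0 -ltnNge; case: ltnP => // h.
by rewrite -{2}(subnK h) modnDr.
Qed.

Lemma reducen_ltM q n x : 0 < n -> x < n.+1 * q -> reducen q x < n * q.
Proof. by move=> n0; rewrite /reducen; case: eqP => /=; rewrite mulSn; nia. Qed.

Lemma modn_reduce2 q x : x < 3 * q -> reducen q (reducen q x) = x %% q.
Proof.
move=> h; rewrite reducenE ?modn_reducen // -mul2n.
exact: (@reducen_ltM _ 2).
Qed.

Lemma modn_reduce3 q x : x < 4 * q ->
  reducen q (reducen q (reducen q x)) = x %% q.
Proof.
move=> h; rewrite modn_reduce2 ?modn_reducen //.
exact: (@reducen_ltM _ 3).
Qed.

Lemma startP K w wa q (bad : bool) l k i m :
  let env := [:: l; k; K; K * K; K * K * K; i] in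
  0 < K -> i + 2 = q -> frame K w wa m ->
  (forall t, t < 4 * K ^ 3 -> m (ofs_new K + t) = 0) -> m (ofs_bad K) = bad ->
  represents K w wa q (start_weight K wa) bad (sem start env m).
Proof.
move=> env K0 hq hf hW hB; set big := For (Cst 3) (For (Cst 3)
  (For (Cst 2) (For (Cst 2) (push
  (eidx (Cst 0) (Var 9)
    (reduce (reduce (reduce (Add (Var 7) (Cst 1)) vK) vK) vK) (Var 10)
    (reduce (reduce (reduce (Add (Var 8) (Cst 1)) vK) vK) vK))
  (xor (xor (parity (Add (Var 7) (Cst 1)))
            (parity (Add (Add (Var 7) (Cst 1)) (Var 9))))
       (xor (parity (Add (Var 8) (Cst 1)))
            (parity (Add (Add (Var 8) (Cst 1)) (Var 10))))) (Cst 1))))).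
rewrite -[sem start env m]/(sem flush (rcons env 0) (sem big (rcons env 0) m)).
set env0 := rcons env 0.
have H : adds (ofs_new K) (4 * K ^ 3) q m (sem big env0) (start_weight K wa).
  rewrite /big /start_weight; apply: adds_For => // n1 h1.
  apply: adds_For => // n2 h2; apply: adds_For => // c1 hc1.
  apply: adds_For => // c2 hc2.
  have -> : forall b, sign b = (sign b * 1)%R by move=> b; rewrite mulr1.
  apply: adds_push => //; first by rewrite idx_lt // ltn_mod.
  move=> m' hm'; rewrite [rcons _ _]/=; set env' := _ :: _.
  have hs' : std K env' by [].
  have hf' : frame K w wa m'.
    by apply: frame_eq hf => x hx; apply/hm'/outside_old/ltn_addr.
  have [_ hpar _] := hf'.
  have hp x : eval x env' m' < 6 -> eval (parity x) env' m' = wa (eval x env' m').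
    by move=> lt; rewrite -hpar // mul2n -addnn.
  have hr x : eval x env' m' < 4 ->
      eval (reduce (reduce (reduce x vK) vK) vK) env' m' = eval x env' m' %% K.
    move=> lt; rewrite !eval_reduce; apply: modn_reduce3.
    by rewrite [eval vK _ _]/=; lia.
  split.
  - rewrite (eval_idx _ hs' hf') //; last 1 first.
    + by rewrite hr ?ltn_mod //= addn1.
    + by rewrite !hr /= ?addn1.
  - by apply: eval_xor; apply: eval_xor;
      rewrite hp /= ?addn1 //; lia.
  - by rewrite /residue [eval _ _ _]/= subrr rpred0 andbT -hq addn2.
have q0 : 0 < q by lia.
have [||h1 h2] := H m; first by [].
  by move=> t ht; rewrite hW.
apply: flushP => //.
- by apply: frame_eq hf => x hx; apply/h1/outside_old/ltn_addr.
- by rewrite h1 //; apply: outside_bad.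
- by move=> t ht; move: (h2 t ht); rewrite hW // add0r.
Qed.

(** This is S_j, in the form in which the program computes it modulo each q. *)
Definition tested_energy (K : nat) (w wa : nat -> bool) (k j : nat) : int :=
  energy K (iter j (push_weight K 2 w)
    (iter (k + k) (push_weight K 1 w) (start_weight K wa))).

Definition refuted (K : nat) (w wa : nat -> bool) (k q J : nat) : bool :=
  has (fun j => ~~ (q %| tested_energy K w wa k j)%Z) (iota 0 J).

Lemma has_iotaS (p : pred nat) n : has p (iota 0 n.+1) = has p (iota 0 n) || p n.
Proof. by rewrite -addn1 iotaD has_cat /= orbF. Qed.

Lemma testP K w wa q (bad : bool) l k i m :
  let env := [:: l; k; K; K * K; K * K * K; i] in
  0 < K -> i + 2 = q -> frame K w wa m ->
  (forall t, t < 4 * K ^ 3 -> m (ofs_new K + t) = 0) -> m (ofs_bad K) = bad ->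
  exists Y, represents K w wa q Y (bad || refuted K w wa k q (4 * K ^ 3))
    (sem (Then start (Then (For (twice (Var 1)) (advance 1))
                           (For eX4 (Then check (advance 2))))) env m).
Proof.
move=> env K0 hq hf hW hB; rewrite !sem_Then.
have h1 := startP l k K0 hq hf hW hB; set m1 := sem start _ _ in h1 *.
have h2 : represents K w wa q
    (iter (k + k) (push_weight K 1 w) (start_weight K wa)) bad
    (sem (For (twice (Var 1)) (advance 1)) env m1).
  rewrite sem_For; set f := fun j => _; rewrite [eval _ _ _]/=.
  apply: (@repeat_ind (fun n => represents K w wa q
    (iter n (push_weight K 1 w) (start_weight K wa)) bad)) => // j m' _ h.
  exact: advanceP hq _ h.
set m2 := sem _ _ m1 in h2 *.
eexists; rewrite sem_For; have [_ _ _ _ ->] := @eval_offsets K env m2 (And3 erefl erefl erefl).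
apply: (@repeat_ind (fun n => represents K w wa q
    (iter n (push_weight K 2 w) (iter (k + k) (push_weight K 1 w)
      (start_weight K wa))) (bad || refuted K w wa k q n))).
  by rewrite orbF.
move=> j m' _ h; rewrite sem_Then [rcons _ _]/=.
have h' := checkP l k j hq h; rewrite -orbA /refuted -has_iotaS in h'.
exact: advanceP hq _ h'.
Qed.

Lemma paritiesP K (w wa : nat -> bool) l k (m : nat -> nat) (env := [:: l; k; K; K * K; K * K * K]) : 0 < K ->
  (forall v, v < 2 * K -> m v = w v) ->
  (forall x, x < 6 -> m (2 * K + x) = 0) -> wa 0 = false ->
  (forall n b, b < 2 -> wa (n.*2 + b) = wa n (+) w ((n.*2 + b) %% K.*2)) ->
  (forall x, (x < 2 * K) || (2 * K + 6 <= x) ->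
    sem parities env m x = m x) /\
  (forall x, x < 6 -> sem parities env m (2 * K + x) = wa x).
Proof.
rewrite /env => {env} K0 hw h0 wa0 hwa; set s := sem parities _ m.
(* Entry 0 counts as correct from the outset, being 0 in the memory: the iteration for x = 0 reads
   the entry that it writes. *)
pose P n m' := (forall x, (x < 2 * K) || (2 * K + 6 <= x) -> m' x = m x) /\
  (forall x, x < maxn 1 n -> m' (2 * K + x) = wa x).
suff [h1 h2] : P 6 s by split.
apply: (@repeat_ind (fun n => P n.*2)).
  by split=> // x; rewrite maxn0 ltnS leqn0 => /eqP ->; rewrite h0 // wa0.
move=> n m1 hn0 hP; have hn : n < 3 := hn0; have -> : n.+1.*2 = n.*2 + 2 by lia.
apply: (@repeat_ind (fun b => P (n.*2 + b))).
  by rewrite addn0.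
move=> b m2 hb0 [i1 i2]; have hb : b < 2 := hb0; rewrite [rcons _ _]/=; set env' := _ :: _.
set x := n.*2 + b in i2 *.
have -> : update m2 (eval (Add eL (digit (Var 6) (Var 5))) env' m2)
    (eval (xor (parity (Var 5))
       (Get (reduce (reduce (digit (Var 6) (Var 5)) eL) eL))) env' m2) =
    update m2 (2 * K + x) (wa x).
  have hx : eval (digit (Var 6) (Var 5)) env' m2 = x by rewrite eval_digit.
  have hL : eval eL env' m2 = 2 * K by rewrite mul2n -addnn.
  rewrite eval_Add hx hL hwa //; congr update; apply: eval_xor.
    rewrite -[LHS]/(m2 (eval eL env' m2 + n)) hL i2 //.
    by rewrite /x; lia.
  set f := reduce _ eL; rewrite -[LHS]/(m2 (eval f env' m2)) /f !eval_reduce.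
  rewrite hx hL modn_reduce2; last by rewrite /x; lia.
  have lt : x %% (2 * K) < 2 * K by rewrite ltn_mod; lia.
  by rewrite i1 ?lt // hw // mul2n.
split=> y hy; rewrite /update.
  by rewrite ifN ?i1 //; move: hy; rewrite /x; lia.
rewrite eqn_add2l; case: eqP => [-> //|ne]; apply: i2.
by move: hy; rewrite addnS -/x; lia.
Qed.

Lemma multiplesP K n i N env m : size env = i -> nth 0 env 2 = K -> 2 < i ->
  n < i -> nth 0 env n = N -> m (2 * K + 6) = 0 ->
  (forall x, (x <= 2 * K + 6) || (2 * K + 6 + N < x) ->
    sem (multiples n i) env m x = m x) /\
  (forall x, x <= N -> sem (multiples n i) env m (2 * K + 6 + x) = K * x).
Proof.
move=> hz hK i2 ni hN h0; rewrite /multiples sem_For [eval _ _ _]/= hN.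
set f := fun i => _.
pose P j m' := (forall x, (x <= 2 * K + 6) || (2 * K + 6 + N < x) -> m' x = m x)
  /\ (forall x, x <= j -> m' (2 * K + 6 + x) = K * x).
suff [h1 h2] : P N (repeat f N m) by split.
apply: (@repeat_ind P); first split=> //.
  by move=> x; rewrite leqn0 => /eqP ->; rewrite addn0 h0 muln0.
move=> j m' hj [p1 p2].
have -> : f j m' = update m' (2 * K + 6 + j.+1) (m' (2 * K + 6 + j) + K).
  rewrite /f /=.
  have -> : nth 0 (rcons env j) 2 = K by rewrite nth_rcons hz i2.
  have -> : nth 0 (rcons env j) i = j by rewrite nth_rcons hz ltnn eqxx.
  have -> : K + K + 6 + j + 1 = 2 * K + 6 + j.+1 by lia.
  by have -> : K + K + 6 + j = 2 * K + 6 + j by lia.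
split=> x hx; rewrite /update.
  by case: eqP => [e|_]; [lia|apply: p1].
rewrite eqn_add2l; case: eqP => [->|ne]; first by rewrite p2 // mulnS addnC.
by apply: p2; lia.
Qed.

Definition rejected (K : nat) (w wa : nat -> bool) (k : nat) : bool :=
  has (fun i => refuted K w wa k (i + 2) (4 * K ^ 3)) (iota 0 (16 * K ^ 3)).

Lemma mainP K (w wa : nat -> bool) l k (m : nat -> nat)
    (env := [:: l; k; K; K * K; K * K * K]) : 0 < K ->
  (forall v, v < 2 * K -> m v = w v) ->
  (forall x, x < 6 -> m (2 * K + x) = 0) ->
  (forall x, x <= K ^ 2 -> m (2 * K + 6 + x) = K * x) ->
  (forall x, ofs_old K <= x -> m x = 0) -> wa 0 = false ->
  (forall n b, b < 2 -> wa (n.*2 + b) = wa n (+) w ((n.*2 + b) %% K.*2)) ->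
  sem main env m 0 = ~~ rejected K w wa k.
Proof.
move=> K0 hw hp hT hz wa0 hwa; rewrite /main !sem_Then.
have [h1 h2] := paritiesP l k K0 hw hp wa0 hwa.
move: h1 h2; rewrite -/env; set m1 := sem parities env m => h1 h2.
have hs : std K env by [].
have [u1 u2 u3 u4 u5] := eval_offsets m1 hs.
set body := Then start _; set loop := For _ body.
pose P (n : nat) (bad : bool) m' := [/\ frame K w wa m',
  forall t, t < 4 * K ^ 3 -> m' (ofs_new K + t) = 0 & m' (ofs_bad K) = bad].
have big x : ofs_old K <= x -> m1 x = 0.
  by move=> hx; rewrite h1 ?hz //; move: hx; rewrite /ofs_old; lia.
have HP : P 0 (rejected K w wa k) (sem loop env m1).
  rewrite /rejected /loop sem_For.
  have -> : eval (twice (twice eX4)) env m1 = 16 * K ^ 3.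
    rewrite -[LHS]/(eval eX4 env m1 + eval eX4 env m1 +
      (eval eX4 env m1 + eval eX4 env m1)) u5; lia.
  apply: (@repeat_ind (fun n => P 0
    (has (fun i => refuted K w wa k (i + 2) (4 * K ^ 3)) (iota 0 n)))).
    split.
    - split=> x hx; last first.
      + by rewrite h1 ?hT //; lia.
      + exact: h2.
      + by rewrite h1 ?hw // hx.
    - by move=> t ht; rewrite big // /ofs_new -addnA leq_addr.
    - by rewrite big // /ofs_bad /ofs_acc /ofs_new; lia.
  move=> i m' _ [f1 f2 f3]; rewrite has_iotaS.
  have [Y [g1 _ g3 g4]] := testP l k K0 (erefl (i + 2)) f1 f2 f3.
  by split.
case: HP; set m2 := sem loop env m1 => _ _ hb.
have [_ _ _ v4 _] := eval_offsets m2 hs.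
rewrite -[LHS]/(update m2 0 (1 - m2 (eval eB env m2)) 0) v4 hb.
by rewrite /update /=; case: (rejected _ _ _ _).
Qed.

Lemma powersP k l (m : nat -> nat) (env := [:: l; k]) : m 0 = 1 ->
  forall x, sem (For (Var 1) (Write (Cst 0) (twice (Get (Cst 0))))) env m x =
  if x == 0 then 2 ^ k else m x.
Proof.
move=> h1; rewrite sem_For [eval _ _ _]/=.
apply: (@repeat_ind (fun n m' => forall x, m' x = if x == 0 then 2 ^ n else m x)).
  by move=> x; case: eqP => // ->.
move=> i m' _ h x; rewrite /= /update h /= expnS mul2n addnn.
by case: ifP => // hx; rewrite h hx.
Qed.

Lemma decideP : exists c : nat, forall (l : nat) (w wa : nat -> bool) (m : nat -> nat),
  0 < l -> w 0 = false -> (forall x, m x = if x < 2 ^ l then (w x : nat) else 0) ->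
  wa 0 = false ->
  (forall n b, b < 2 -> wa (n.*2 + b) = wa n (+) w ((n.*2 + b) %% 2 ^ l)) ->
  sem decide [:: l] m 0 = ~~ rejected (2 ^ l.-1) w wa l.-1 /\
  cost decide [:: l] m <= 2 ^ (c * l).
Proof.
(* The constant is left open and is determined at the end, when [cbound] is evaluated on the
   concrete commands; it cannot depend on l. *)
eexists=> l w wa m l0 w0 hm wa0 hwa.
set K := 2 ^ l.-1; have hK : 2 ^ l = K.*2 by rewrite -{1}(prednK l0) expnS mul2n.
have K0 : 0 < K by rewrite expn_gt0.
rewrite hK in hm hwa.
rewrite /decide; set m1 := update m 0 1.
have hmB := @powersP l.-1 l m1 erefl.
set cB := For _ _ in hmB *; set mB := sem cB _ _ in hmB.
(* Cell 0 was scratch space for computing K. Writing 0 restores the input because [w 0] is false,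
   that is, because the zero word is not in A. *)
set mC := update mB 0 0.
have hmC x : mC x = m x.
  rewrite /mC /update hmB; case: eqP => [->|/eqP nx].
    by rewrite hm w0; case: ifP.
  by rewrite /m1 /update (negbTE nx).
have zC x : 2 * K <= x -> mC x = 0.
  by rewrite hmC hm mul2n ltnNge => ->.
pose envD := [:: l; l.-1; K].
have [d1 d2] := @multiplesP K 2 3 K envD mC erefl erefl erefl erefl erefl
  (zC _ (leq_addr _ _)).
set mD := sem _ envD mC in d1 d2.
have hK2 : mD (2 * K + 6 + K) = K * K by rewrite d2.
pose envF := [:: l; l.-1; K; K * K].
have [|f1 f2] := @multiplesP K 3 4 (K * K) envF mD erefl erefl erefl erefl erefl.
  by rewrite d1 ?leqnn // zC // leq_addr.
set mF := sem _ envF mD in f1 f2.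
have hX : mF (2 * K + 6 + K * K) = K * K * K by rewrite f2 // mulnA.
pose envG := [:: l; l.-1; K; K * K; K * K * K].
have low x : x <= 2 * K + 6 -> mF x = m x.
  by move=> hx; rewrite f1 ?hx // d1 ?hx // hmC.
have hmain : sem main envG mF 0 = ~~ rejected K w wa l.-1.
  apply: mainP => //.
  - by move=> v hv; rewrite low ?hm -?mul2n ?hv //; lia.
  - move=> x hx; rewrite low; last by lia.
    by rewrite -hmC zC // leq_addr.
  - move=> x; rewrite /ofs_old -mulnn => hx; rewrite f1; last by lia.
    by rewrite d1 ?zC //; nia.
have K2E c : sem (Let (mulK vK) c) envD mD = sem c envF mD.
  rewrite -[LHS]/(sem c (rcons envD (mD (K + K + 6 + K))) mD).
  by rewrite addnn -mul2n hK2.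
have XE c : sem (Let (mulK (Var 3)) c) envF mF = sem c envG mF.
  rewrite -[LHS]/(sem c (rcons envF (mF (K + K + 6 + K * K))) mF).
  by rewrite addnn -mul2n hX.
have KE c : sem (Let (Get (Cst 0)) c) [:: l; l.-1] mB = sem c envD mB.
  by rewrite -[LHS]/(sem c (rcons [:: l; l.-1] (mB 0)) mB) hmB.
have kE c : sem (Let (Sub (Var 0) (Cst 1)) c) [:: l] m = sem c [:: l; l.-1] m.
  by rewrite -[LHS]/(sem c (rcons [:: l] (l - 1)) m) subn1.
have K2T c : cost (Let (mulK vK) c) envD mD = ecost (mulK vK) + cost c envF mD.
  rewrite -[LHS]/(_ + cost c (rcons envD (mD (K + K + 6 + K))) mD).
  by rewrite addnn -mul2n hK2.
have XT c : cost (Let (mulK (Var 3)) c) envF mF =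
    ecost (mulK (Var 3)) + cost c envG mF.
  rewrite -[LHS]/(_ + cost c (rcons envF (mF (K + K + 6 + K * K))) mF).
  by rewrite addnn -mul2n hX.
have KT c : cost (Let (Get (Cst 0)) c) [:: l; l.-1] mB = 2 + cost c envD mB.
  by rewrite -[LHS]/(_ + cost c (rcons [:: l; l.-1] (mB 0)) mB) hmB.
have kT c : cost (Let (Sub (Var 0) (Cst 1)) c) [:: l] m =
    4 + cost c [:: l; l.-1] m.
  by rewrite -[LHS]/(_ + cost c (rcons [:: l] (l - 1)) m) subn1.
split.
  by rewrite kE 2!sem_Then -/mB KE 2!sem_Then -/mD K2E sem_Then -/mF XE.
have hl : l <= 2 ^ (1 * l) by apply: leq_trans (ltnW (ltn_expl l (ltnSn 1))) _; rewrite mul1n.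
have hK1 : K <= 2 ^ (1 * l) by rewrite leq_exp2l // mul1n leq_pred.
have hKK : K * K <= 2 ^ (2 * l) := leq_pow2_mul hK1 hK1.
have hKKK : K * K * K <= 2 ^ (3 * l) := leq_pow2_mul hKK hK1.
have bG : bounded l envG [:: 1; 1; 1; 2; 3].
  by case=> [|[|[|[|[|i]]]]] //=; rewrite ?nth_nil //; apply: leq_trans (leq_pred _) _.
have bF : bounded l envF [:: 1; 1; 1; 2].
  by case=> [|[|[|[|i]]]] //=; rewrite ?nth_nil //; apply: leq_trans (leq_pred _) _.
have bD : bounded l envD [:: 1; 1; 1].
  by case=> [|[|[|i]]] //=; rewrite ?nth_nil //; apply: leq_trans (leq_pred _) _.
have bB : bounded l [:: l; l.-1] [:: 1; 1].
  by case=> [|[|i]] //=; rewrite ?nth_nil //; apply: leq_trans (leq_pred _) _.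
have costThen c1 c2 env m' : cost (Then c1 c2) env m' =
  cost c1 env m' + cost c2 env (sem c1 env m') by [].
rewrite kT 2!costThen -/mB KT 2!costThen -/mD K2T costThen -/mF XT.
apply: (leq_pow2D l0 (leq_pow2M 4 l0)).
apply: leq_pow2D => //; first by eapply cboundP; [| |exact: bB|].
apply: leq_pow2D => //; first by eapply cboundP; [| |exact: bB|].
apply: (leq_pow2D l0 (leq_pow2M 2 l0)).
apply: leq_pow2D => //; first by eapply cboundP; [| |exact: bD|].
apply: leq_pow2D => //; first by eapply cboundP; [| |exact: bD|].
apply: (leq_pow2D l0 (leq_pow2M _ l0)).
apply: leq_pow2D => //; first by eapply cboundP; [| |exact: bF|].
apply: (leq_pow2D l0 (leq_pow2M _ l0)).
by eapply cboundP; [| |exact: bG|].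
Qed.

(** * Words as numbers and the initial memory *)

Lemma word_value_rcons v b : word_value (rcons v b) = (word_value v).*2 + b.
Proof. by rewrite /word_value -cats1 foldl_cat. Qed.

Lemma word_value_lt v : word_value v < 2 ^ size v.
Proof.
elim/last_ind: v => // v b IH.
by rewrite word_value_rcons size_rcons expnS mul2n; case: b; lia.
Qed.

Lemma word_value_cat u v :
  word_value (u ++ v) = word_value u * 2 ^ size v + word_value v.
Proof.
elim/last_ind: v => [|v b IH]; first by rewrite cats0 muln1 addn0.
by rewrite -rcons_cat !word_value_rcons IH size_rcons expnS; lia.
Qed.

Lemma word_value_inj u v :
  size u = size v -> word_value u = word_value v -> u = v.
Proof.
elim/last_ind: u v => [|u a IH] v; first by move/esym/size0nil.
elim/last_ind: v => [|v b _]; first by rewrite size_rcons.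
rewrite !size_rcons !word_value_rcons => -[hs] e.
have eab : a = b.
  by move: (congr1 odd e); rewrite !oddD !odd_double !oddb.
by rewrite eab (IH v) //; move: e; rewrite eab; lia.
Qed.

Lemma word_value_nseq0 n : word_value (nseq n false) = 0.
Proof. by elim: n => //= n; rewrite /word_value /= => ->. Qed.

Definition member (l : nat) (A : {set l.-tuple bool}) (x : nat) : bool :=
  [exists v in A, word_value v == x].

Lemma member0 l (A : {set l.-tuple bool}) :
  nseq_tuple l false \notin A -> member A 0 = false.
Proof.
rewrite /member => hA; apply/negbTE/exists_inP => -[v vA /eqP hv].
case/negP: hA; rewrite (_ : nseq_tuple l false = v) //; apply/val_inj => /=.
apply: word_value_inj; first by rewrite size_nseq size_tuple.
by rewrite word_value_nseq0 hv.
Qed.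

Lemma decision_programP : exists c : nat,
  forall (l : nat) (A : {set l.-tuple bool}) (wa : nat -> bool),
    0 < l -> nseq_tuple l false \notin A -> wa 0 = false ->
    (forall n b, b < 2 ->
      wa (n.*2 + b) = wa n (+) member A ((n.*2 + b) %% 2 ^ l)) ->
    exists (t : nat) (s : state),
      [/\ exec decision_program (input_state A) t s, t <= 2 ^ (c * l) &
       regs s 0 = ~~ rejected (2 ^ l.-1) (member A) wa l.-1].
Proof.
have [c hc] := decideP; exists (c + 2 + 1) => l A wa l0 hA wa0 hwa.
have hm x : cells (input_state A) x = if x < 2 ^ l then member A x : nat else 0.
  rewrite /= -/(member A x); case: ifP => // /negbT hx.
  suff /negbTE -> : ~~ member A x by [].
  apply: contra hx; rewrite /member => /exists_inP [v _ /eqP <-].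
  by rewrite -{2}(size_tuple v) word_value_lt.
have [h1 h2] := hc l (member A) wa _ l0 (member0 hA) hm wa0 hwa.
have hh : holds [:: l] (input_state A) by case.
have [t [s [x1 lt1 _ e1]]] := compileP decide hh.
exists (t + (1 + 1)), (set_reg (set_reg s 1 0) 0 (cells s 0)); split.
- apply: ExecSeq x1 _; apply: (@ExecSeq _ _ _ _ (set_reg s 1 0)).
    exact: ExecConst.
  exact: (ExecFetch (set_reg s 1 0) 0 1).
- apply: leq_pow2D => //; first exact: leq_trans h2.
  exact: (leq_pow2M 2).
- by rewrite /= /update /= e1 h1.
Qed.

(** * Pattern counts and digits *)

Definition occurs_at (v w : word) (i : nat) : bool :=
  (i + size v <= size w) && (take (size v) (drop i w) == v).

Lemma occurs_atE (v w : word) i : i <= size w ->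
  (w == take i w ++ v ++ drop (i + size v) w) = occurs_at v w i.
Proof.
move=> iw; rewrite /occurs_at.
rewrite -{1}(cat_take_drop i w) eqseq_cat // eqxx /=.
rewrite -{1}(cat_take_drop (size v) (drop i w)) drop_drop [size v + i]addnC.
have [le|gt] := leqP (i + size v) (size w).
  rewrite eqseq_cat ?eqxx ?andbT //.
  by rewrite size_takel // size_drop /=; lia.
apply/eqP => /(congr1 size); rewrite !size_cat size_take !size_drop /=.
by case: ltnP => h; lia.
Qed.

(** A factorization x v y of w is determined by the length of x, so pairs of words can be replaced
    by positions. *)
Lemma factorizationsE (v w : word) :
  factorizations v w = \sum_(0 <= i < (size w).+1) occurs_at v w i.
Proof.
have p1 i : size (take i w) <= size w by rewrite size_take_min geq_minr.
have p2 i : size (drop i w) <= size w by rewrite size_drop leq_subr.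
have split_at (a b : word) : w = a ++ v ++ b ->
    take (size a) w = a /\ drop (size a + size v) w = b.
  by move=> ->; rewrite take_size_cat // addnC -drop_drop !drop_size_cat.
pose f (i : 'I_(size w).+1) : (size w).-bseq bool * (size w).-bseq bool :=
  (Bseq (p1 i), Bseq (p2 (i + size v))).
rewrite /factorizations big_mkord -sum1_card.
pose S := [set i : 'I_(size w).+1 | occurs_at v w i].
transitivity (\sum_(i in S) 1); last first.
  rewrite big_mkcond; apply: eq_bigr => i _; rewrite inE.
  by case: (occurs_at _ _ _).
rewrite -(big_imset (h := f) (A := S) (fun=> 1)) /=.
  apply: eq_bigl => p; rewrite inE; apply/eqP/imsetP => [e|[i hi ->]].
    have lt : size p.1 < (size w).+1 by apply: size_bseq.
    have [t1 t2] := split_at _ _ e.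
    exists (Ordinal lt); first by rewrite inE -occurs_atE //= t1 t2 -e.
    by case: p e lt t1 t2 => a b /= e lt t1 t2; congr (_, _); apply: val_inj.
  by apply/eqP; move: hi; rewrite inE -occurs_atE //= -ltnS.
move=> i j _ _ [e _]; apply/val_inj => /=.
have := congr1 size e; rewrite !size_takel //; by rewrite -ltnS.
Qed.

(** Appending a letter creates exactly one new candidate, the window that ends at this letter. *)
Lemma factorizations_rcons (v w : word) b : 0 < size v <= (size w).+1 ->
  factorizations v (rcons w b) =
  factorizations v w + (drop ((size w).+1 - size v) (rcons w b) == v).
Proof.
move=> /andP[v0 hv]; rewrite !factorizationsE size_rcons.
pose g i := occurs_at v (rcons w b) i : nat.
have hi : (size w).+1 - size v < (size w).+2 by lia.
have key i : i <= size w -> g i = occurs_at v w i +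
    (((size w).+1 - size v == i) &&
     (drop ((size w).+1 - size v) (rcons w b) == v)).
  move=> iw; rewrite /g /occurs_at size_rcons drop_rcons //.
  have [ei|ne] := eqVneq ((size w).+1 - size v) i.
    rewrite -ei subnK // leqnn ltnn /=.
    rewrite -[X in take X](_ : size (drop ((size w).+1 - size v) (rcons w b)) = _).
      by rewrite drop_rcons ?take_size //; lia.
    by rewrite size_drop size_rcons /=; lia.
  rewrite addn0; case: leqP => le1; last by rewrite leqNgt (ltnW le1).
  have le2 : i + size v <= size w by move/eqP: ne; lia.
  rewrite le2 -cats1 takel_cat //.
  by rewrite size_drop /=; lia.
have last0 : g (size w).+1 = 0.
  rewrite /g /occurs_at size_rcons.
  by have -> : ((size w).+1 + size v <= (size w).+1) = false by lia.
rewrite big_nat_recr //= -/(g _) last0 addn0.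
rewrite (eq_big_nat _ _ (F2 := fun i => occurs_at v w i +
    (((size w).+1 - size v == i) &&
     (drop ((size w).+1 - size v) (rcons w b) == v)))).
  rewrite big_split /=; congr (_ + _).
  have lt : (size w).+1 - size v < (size w).+1 by lia.
  rewrite big_mkord (bigD1 (Ordinal lt)) //= eqxx big1 ?addn0 // => i.
  by rewrite -val_eqE /= eq_sym => /negbTE ->.
by move=> i /andP[_ hi']; apply: key.
Qed.

Lemma up_log2_digit n b : b < 2 -> 0 < n.*2 + b ->
  up_log 2 (n.*2 + b).+1 = (up_log 2 n.+1).+1.
Proof.
case: n b => [|n] [|[|b]] // hb _; apply: up_log_eq => //.
all: have /andP[] := up_log_bounds (ltnSn 1) (isT : 1 < n.+2).
all: have : 0 < up_log 2 n.+2 by rewrite up_log_gt0.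
all: by case: (up_log 2 n.+2) => // s _ /=; rewrite !expnS; lia.
Qed.

Lemma binary_expansion0 : binary_expansion 0 = [::].
Proof. by rewrite /binary_expansion up_log1. Qed.

Lemma binary_expansion_digit n (b : bool) : 0 < n.*2 + b ->
  binary_expansion (n.*2 + b) = rcons (binary_expansion n) b.
Proof.
move=> h; rewrite /binary_expansion up_log2_digit //; last by case: (b).
rewrite /mkseq [iota 0 _.+1]/= map_cons rev_cons; congr rcons; last first.
  by rewrite divn1 oddD odd_double; case: (b).
congr rev; rewrite -[1]/(1 + 0) iotaDl -map_comp; apply: eq_map => i /=.
rewrite add1n expnS divnMA; congr (odd (_ %/ _)).
by rewrite -muln2 divnMDl // divn_small ?addn0 //; case: (b).
Qed.

Lemma padded_expansion_digit k n (b : bool) : 0 < n.*2 + b ->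
  padded_expansion k (n.*2 + b) = rcons (padded_expansion k n) b.
Proof.
by move=> h; rewrite /padded_expansion binary_expansion_digit // rcons_cat.
Qed.

Lemma word_value_expansion k n : word_value (padded_expansion k n) = n.
Proof.
rewrite word_value_cat word_value_nseq0 add0n.
elim/ltn_ind: n => n IH; have [->|n0] := posnP n.
  by rewrite binary_expansion0.
have e : n = (n./2).*2 + odd n by rewrite addnC odd_double_half.
rewrite e binary_expansion_digit -?e // word_value_rcons IH //.
by rewrite -divn2 ltn_Pdiv.
Qed.

Lemma word_value_drop i w :
  word_value (drop i w) = word_value w %% 2 ^ (size w - i).
Proof.
rewrite -{2}(cat_take_drop i w) word_value_cat -size_drop modnMDl modn_small //.
exact: word_value_lt.
Qed.

Definition pattern_parity (l : nat) (A : {set l.-tuple bool}) (n : nat) : bool :=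
  odd (\sum_(v in A) occurrences v n).

Lemma pattern_parity0 l (A : {set l.-tuple bool}) :
  0 < l -> pattern_parity A 0 = false.
Proof.
move=> l0; rewrite /pattern_parity big1 // => v _.
rewrite /occurrences /padded_expansion binary_expansion0 cats0 factorizationsE.
rewrite big1_seq // => i _; rewrite /occurs_at size_nseq size_tuple.
by case: leqP => // h; lia.
Qed.

(** Thanks to the l - 1 padding zeros the last window always has full length, and it spells 2 n + b
    mod 2 ^ l. The number 0 is special, since its expansion is empty and no digit is appended; there
    the formula holds because the zero word is not in A. *)
Lemma pattern_parity_digit l (A : {set l.-tuple bool}) n b :
  0 < l -> nseq_tuple l false \notin A -> b < 2 ->
  pattern_parity A (n.*2 + b) =
  pattern_parity A n (+) member A ((n.*2 + b) %% 2 ^ l).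
Proof.
move=> l0 A0 hb; have {hb} [b' ->] : exists b' : bool, b = b'.
  by case: b hb => [|[|//]] _; [exists false|exists true].
have [h0|pos] := posnP (n.*2 + b').
  have n0 : n = 0 by lia.
  by rewrite h0 n0 mod0n member0 // addbF.
rewrite /pattern_parity; set w := padded_expansion l.-1 n.
have hw : l.-1 <= size w by rewrite size_cat size_nseq leq_addr.
pose s := drop ((size w).+1 - l) (rcons w b').
have hs : size s == l by rewrite size_drop size_rcons; apply/eqP; lia.
rewrite (eq_bigr (fun v : l.-tuple bool => occurrences v n + (Tuple hs == v))).
  rewrite big_split oddD; congr (_ (+) _).
  transitivity (Tuple hs \in A).
    case: (boolP (Tuple hs \in A)) => hA.
      rewrite (bigD1 (Tuple hs)) //= eqxx big1 // => v /andP[_ /negbTE].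
      by rewrite eq_sym => ->.
    rewrite big1 // => v vA; case: eqP => // e.
    by rewrite e vA in hA.
  have hv : word_value s = (n.*2 + b') %% 2 ^ l.
    rewrite word_value_drop size_rcons subKn; last by lia.
    by rewrite -padded_expansion_digit // word_value_expansion.
  rewrite /member -hv; apply/idP/exists_inP => [h|[v vA /eqP e]].
    by exists (Tuple hs).
  rewrite (_ : Tuple hs = v) //; apply/val_inj/word_value_inj => //=.
  by rewrite (eqP hs) size_tuple.
move=> v _; rewrite /occurrences size_tuple padded_expansion_digit //.
by rewrite -/w factorizations_rcons (size_tuple v) ?l0 //=; lia.
Qed.

(** * Common multiples *)

(* The numbers 1 / (n C(n - 1, k)) form the Leibniz harmonic triangle: each is
   the difference of an entry of the previous row and its left neighbour. *)
Lemma leibniz_dvd d n k : (forall q, 0 < q <= n -> q %| d) ->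
  k < n -> n * 'C(n.-1, k) %| d.
Proof.
elim: k n => [|k IH] n hd kn; first by rewrite bin0 muln1 hd // leqnn kn.
case: n hd kn => [|[|n]] hd kn //=; have {}kn : k <= n by [].
have [|x ex] := dvdnP (IH n.+1 _ kn).
  by move=> q /andP[q0 qn]; rewrite hd // q0 leqW.
have [y ey] := dvdnP (IH n.+2 hd (leqW kn)).
rewrite /= in ex ey; set u := (n.+1 * 'C(n, k))%N in ex.
have hb : (n.+1 - k) * 'C(n.+1, k) = u by rewrite -mul_bin_down.
have hc : k.+1 * 'C(n.+1, k.+1) = u by rewrite -mul_bin_diag.
have kn' : k <= n.+1 by lia.
have ub : 0 < u by rewrite muln_gt0 bin_gt0 kn.
have c0 : 0 < 'C(n.+1, k.+1) by rewrite bin_gt0.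
have b0 : 0 < 'C(n.+1, k) by rewrite bin_gt0.
move: hb hc; move: ('C(n.+1, k)) ('C(n.+1, k.+1)) b0 c0 ey => b c b0 c0 ey hb hc.
(* The quotient sought is x - y, by the difference rule of the triangle; the equation avoids
   subtraction and is proved after multiplication by [k.+1]. *)
suff e : d + y * (n.+2 * c) = x * (n.+2 * c).
  by rewrite -(@dvdn_addl (y * (n.+2 * c))) ?e dvdn_mull.
have e1 : k.+1 * (d + y * (n.+2 * c)) = k.+1 * (x * (n.+2 * c)).
  have -> : k.+1 * (x * (n.+2 * c)) = n.+2 * (x * (k.+1 * c)) by ring.
  have -> : k.+1 * (d + y * (n.+2 * c)) = k.+1 * d + y * n.+2 * (k.+1 * c) by ring.
  rewrite hc -ex -hb.
  have -> : y * n.+2 * ((n.+1 - k) * b) = (n.+1 - k) * d by rewrite ey; ring.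
  by rewrite -mulnDl; congr (_ * _); lia.
by move/eqP: e1; rewrite eqn_pmul2l // => /eqP.
Qed.

(** The n binomial coefficients 'C(n - 1, k) add up to 2 ^ (n - 1), and n times each of them divides
    d. *)
Lemma leq_common_multiple d n : 0 < d -> 0 < n ->
  (forall q, 0 < q <= n -> q %| d) -> 2 ^ n.-1 <= d.
Proof.
move=> d0 n0 hd; rewrite -(leq_pmul2l n0) -[2]/(1 + 1) Pascal big_distrr /=.
rewrite (prednK n0) -[X in _ <= X * d]card_ord -sum_nat_const.
apply: leq_sum => k _; rewrite !exp1n !muln1.
by apply: dvdn_leq => //; apply: leibniz_dvd.
Qed.

(** * The tested quantity as a sum of squares of correlations *)

Lemma base_inj K r r' u u' : r < K -> r' < K ->
  (r + K * u == r' + K * u') = (r == r') && (u == u').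
Proof.
move=> hr hr'; apply/eqP/andP => [e|[/eqP -> /eqP ->] //].
have er : r = r'.
  by move: (congr1 (modn^~ K) e); rewrite ![_ + K * _]addnC ![K * _]mulnC
    !modnMDl !modn_small.
split; first by rewrite er.
by move/eqP: e; rewrite er eqn_add2l eqn_pmul2l //; apply: leq_ltn_trans hr.
Qed.

(** [idx] is a mixed radix expansion: digits r2, r1, M in base K, then c2, c1 in base 2. *)
Lemma idx_eq K M c1 r1 c2 r2 M' c1' r1' c2' r2' :
  M < K -> r1 < K -> r2 < K -> c1 < 2 -> c2 < 2 ->
  M' < K -> r1' < K -> r2' < K -> c1' < 2 -> c2' < 2 ->
  (idx K M c1 r1 c2 r2 == idx K M' c1' r1' c2' r2') =
  [&& M == M', r1 == r1', r2 == r2', c1 == c1' & c2 == c2'].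
Proof.
move=> hM h1 h2 hc1 hc2 hM' h1' h2' hc1' hc2'.
have lt x y z : x < K -> y < K -> z < K -> x + K * (y + K * z) < K ^ 3.
  by move=> *; rewrite !expnS expn0; nia.
have idxE x c y d z : idx K x c y d z =
    z + K * (y + K * x) + K ^ 3 * (d + 2 * c) by rewrite /idx; lia.
rewrite !idxE base_inj ?lt // base_inj // base_inj // base_inj //.
by case: (M == M'); case: (r1 == r1'); case: (r2 == r2'); case: (c1 == c1');
  case: (c2 == c2').
Qed.

Local Open Scope ring_scope.

Lemma sum_pick K (x : nat) (c : int) : (x < K)%N ->
  \sum_(0 <= r < K) (if x == r then c else 0) = c.
Proof.
move=> hx; rewrite big_mkord (bigD1 (Ordinal hx)) //= eqxx big1 ?addr0 // => i.
by rewrite -val_eqE /= eq_sym => /negbTE ->.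
Qed.

Lemma exchange2 (s1 s2 s : seq nat) (F : nat -> nat -> nat -> int) :
  \sum_(a <- s1) \sum_(b <- s2) \sum_(x <- s) F a b x =
  \sum_(x <- s) \sum_(a <- s1) \sum_(b <- s2) F a b x.
Proof. by do 2 (rewrite [RHS]exchange_big; apply: eq_bigr => ? _). Qed.

Lemma exchange3 (s1 s2 s3 s : seq nat) (F : nat -> nat -> nat -> nat -> int) :
  \sum_(a <- s1) \sum_(b <- s2) \sum_(c <- s3) \sum_(x <- s) F a b c x =
  \sum_(x <- s) \sum_(a <- s1) \sum_(b <- s2) \sum_(c <- s3) F a b c x.
Proof. by do 3 (rewrite [RHS]exchange_big; apply: eq_bigr => ? _). Qed.

Lemma exchange4 (s1 s2 s3 s4 s : seq nat)
    (F : nat -> nat -> nat -> nat -> nat -> int) :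
  \sum_(a <- s1) \sum_(b <- s2) \sum_(c <- s3) \sum_(d <- s4) \sum_(x <- s)
    F a b c d x =
  \sum_(x <- s) \sum_(a <- s1) \sum_(b <- s2) \sum_(c <- s3) \sum_(d <- s4)
    F a b c d x.
Proof. by do 4 (rewrite [RHS]exchange_big; apply: eq_bigr => ? _). Qed.

Lemma exchange5 (s1 s2 s3 s4 s5 s : seq nat)
    (F : nat -> nat -> nat -> nat -> nat -> nat -> int) :
  \sum_(a <- s1) \sum_(b <- s2) \sum_(c <- s3) \sum_(d <- s4) \sum_(e <- s5)
    \sum_(x <- s) F a b c d e x =
  \sum_(x <- s) \sum_(a <- s1) \sum_(b <- s2) \sum_(c <- s3) \sum_(d <- s4)
    \sum_(e <- s5) F a b c d e x.
Proof. by do 5 (rewrite [RHS]exchange_big; apply: eq_bigr => ? _). Qed.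

Lemma sum_residues K (s1 s2 s3 : seq nat) (T : nat -> nat -> nat -> int) :
  (0 < K)%N ->
  \sum_(0 <= M < K) \sum_(0 <= r1 < K) \sum_(0 <= r2 < K)
    \sum_(x <- s1) \sum_(y <- s2) \sum_(z <- s3)
      (if [&& x %% K == M, y %% K == r1 & z %% K == r2]%N then T x y z else 0) =
  \sum_(x <- s1) \sum_(y <- s2) \sum_(z <- s3) T x y z.
Proof.
move=> K0; rewrite exchange3; apply: eq_bigr => x _.
rewrite exchange3; apply: eq_bigr => y _.
rewrite exchange3; apply: eq_bigr => z _.
rewrite -[RHS](@sum_pick K (x %% K)) ?ltn_mod //; apply: eq_bigr => M _.
case: (_ == M); last by rewrite big1 // => ? _; rewrite big1.
rewrite -[RHS](@sum_pick K (y %% K)) ?ltn_mod //; apply: eq_bigr => r1 _.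
case: (_ == r1); last by rewrite big1.
by rewrite /= sum_pick // ltn_mod.
Qed.

Lemma sum_digits a b (F : nat -> int) :
  \sum_(a.*2 <= n < b.*2) F n =
  \sum_(a <= n < b) \sum_(0 <= d < 2) F (n.*2 + d)%N.
Proof.
have [ab|ba] := leqP a b; last first.
  by rewrite !big_geq // ?leq_double ltnW.
rewrite -(subnK ab); elim: (b - a)%N => [|n IH].
  by rewrite add0n !big_geq.
have h1 : (a <= n + a)%N by lia.
rewrite addSn doubleS [RHS]big_nat_recr //= -IH.
rewrite big_nat_recr /=; last by lia.
rewrite big_nat_recr /=; last by lia.
by rewrite unlock /= addn0 addn1 addr0 addrA.
Qed.

Definition pair_bit (wa : nat -> bool) (n m : nat) : bool :=
  wa n (+) wa (n + m)%N.

Definition block_sum (wa : nat -> bool) (nu m : nat) : int :=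
  \sum_(nu <= n < 4 * nu) sign (pair_bit wa n m).

(** The meaning of the array of the program, with nu = 2 ^ N and M < mu. The recursion closes on it
    because both factors share M and carry their own c1, c2. *)
Definition moments (K : nat) (wa : nat -> bool) (mu nu t : nat) : int :=
  \sum_(0 <= M < mu) \sum_(nu <= n1 < 4 * nu) \sum_(nu <= n2 < 4 * nu)
  \sum_(0 <= c1 < 2) \sum_(0 <= c2 < 2)
    (if idx K (M %% K)%N c1 (n1 %% K)%N c2 (n2 %% K)%N == t
     then sign (pair_bit wa n1 (M + c1) (+) pair_bit wa n2 (M + c2)) else 0).

Lemma signM b1 b2 : sign (b1 (+) b2) = sign b1 * sign b2.
Proof. by rewrite /sign signr_addb. Qed.

Lemma moments_idx K wa mu nu M c1 r1 c2 r2 :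
  (M < K)%N -> (r1 < K)%N -> (r2 < K)%N -> (c1 < 2)%N -> (c2 < 2)%N ->
  moments K wa mu nu (idx K M c1 r1 c2 r2) =
  \sum_(0 <= x < mu) \sum_(nu <= y < 4 * nu) \sum_(nu <= z < 4 * nu)
    (if [&& x %% K == M, y %% K == r1 & z %% K == r2]%N
     then sign (pair_bit wa y (x + c1)%N (+) pair_bit wa z (x + c2)%N) else 0).
Proof.
move=> hM h1 h2 hc1 hc2; have K0 : (0 < K)%N by lia.
apply: eq_bigr => x _; apply: eq_bigr => y _; apply: eq_bigr => z _.
set b := [&& _, _ & _].
transitivity (\sum_(0 <= d1 < 2) \sum_(0 <= d2 < 2) (if c1 == d1 then
   if c2 == d2 then if b then
   sign (pair_bit wa y (x + d1)%N (+) pair_bit wa z (x + d2)%N)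
   else 0 else 0 else 0)).
  apply: eq_big_nat => d1 /andP[_ hd1]; apply: eq_big_nat => d2 /andP[_ hd2].
  rewrite idx_eq ?ltn_mod // ![_ == c1]eq_sym ![_ == c2]eq_sym /b.
  by case: (_ == M); case: (_ == r1); case: (_ == r2); case: (c1 == d1);
    case: (c2 == d2).
rewrite -[RHS](@sum_pick 2 c1) //; apply: eq_bigr => d1 _.
case: eqP => [<-|_]; last by rewrite big1.
rewrite -[RHS](@sum_pick 2 c2) //; apply: eq_bigr => d2 _.
by case: eqP => [<-|].
Qed.

Section Doubling.
Variables (K : nat) (w wa : nat -> bool).
Hypothesis K0 : (0 < K)%N.
Hypothesis wa_digit : forall n b, (b < 2)%N ->
  wa (n.*2 + b)%N = wa n (+) w ((n.*2 + b) %% K.*2)%N.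

Lemma modn_double x y : ((x %% K).*2 + y = x.*2 + y %[mod K.*2])%N.
Proof. by rewrite -!mul2n -modnDml -[RHS]modnDml !mul2n -!muln2 -!muln_modl
  modn_mod. Qed.

(** The translate of 2 n + b is 2 (n + M + carry) plus the digit [(e + c + b) %% 2]. Deleting the
    last digits of both numbers thus leaves the shift M + carry and costs the parity of the two last
    windows. *)
Lemma pair_bit_digit n b M e c : (b < 2)%N -> (e < 2)%N -> (c < 2)%N ->
  pair_bit wa (n.*2 + b) (M.*2 + e + c) =
  window_bit w K (M %% K) (n %% K) e c b (+) pair_bit wa n (M + carry e c b).
Proof.
move=> hb he hc; rewrite /pair_bit.
have -> : (n.*2 + b + (M.*2 + e + c) =
    (n + (M + carry e c b)).*2 + (e + c + b) %% 2)%N.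
  rewrite /carry; move: (divn_eq (e + c + b) 2); lia.
rewrite !wa_digit ?ltn_mod // /window_bit.
have -> : ((n.*2 + b) %% K.*2 = (n %% K).*2 + b)%N.
  rewrite -(modn_double n b) modn_small //.
  by have := ltn_pmod n K0; lia.
have -> : ((n + (M + carry e c b)).*2 + (e + c + b) %% 2)%N =
    (n.*2 + (M.*2 + (e + c + b)))%N.
  by rewrite /carry; move: (divn_eq (e + c + b) 2); lia.
have -> : ((n.*2 + (M.*2 + (e + c + b))) %% K.*2 =
    ((n %% K).*2 + b + ((M %% K).*2 + e + c)) %% K.*2)%N.
  rewrite -(modn_double n) addnCA -(modn_double M).
  by congr (_ %% _)%N; lia.
by case: (wa n); case: (w _); case: (wa _); case: (w _).
Qed.

(** The hypothesis on [mu] and [mu'] covers both uses: mu = mu' = 1 for E = 1, and mu' = 2 mu for E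
    = 2. *)
Lemma push_moments E mu mu' nu t : (E <= 2)%N ->
  (forall F : nat -> int, \sum_(0 <= M < mu') F M =
     \sum_(0 <= M < mu) \sum_(0 <= e < E) F (M.*2 + e)%N) ->
  push_weight K E w (moments K wa mu nu) t = moments K wa mu' nu.*2 t.
Proof.
move=> hE hmu.
pose term x y z c1 c2 e b1 b2 : int :=
  if target K (x %% K) (y %% K) (z %% K) c1 c2 e b1 b2 == t
  then sign (pair_bit wa (y.*2 + b1) (x.*2 + e + c1) (+)
             pair_bit wa (z.*2 + b2) (x.*2 + e + c2)) else 0.
transitivity (\sum_(0 <= x < mu) \sum_(nu <= y < 4 * nu) \sum_(nu <= z < 4 * nu)
  \sum_(0 <= c1 < 2) \sum_(0 <= c2 < 2)
  \sum_(0 <= e < E) \sum_(0 <= b1 < 2) \sum_(0 <= b2 < 2)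
    term x y z c1 c2 e b1 b2).
  rewrite -[RHS](sum_residues _ _ _ _ K0).
  apply: eq_big_nat => M /andP[_ hM]; apply: eq_big_nat => r1 /andP[_ h1].
  apply: eq_big_nat => r2 /andP[_ h2].
  transitivity (\sum_(0 <= c1 < 2) \sum_(0 <= c2 < 2)
    \sum_(0 <= e < E) \sum_(0 <= b1 < 2) \sum_(0 <= b2 < 2)
    \sum_(0 <= x < mu) \sum_(nu <= y < 4 * nu) \sum_(nu <= z < 4 * nu)
      if [&& x %% K == M, y %% K == r1 & z %% K == r2]%N
      then term x y z c1 c2 e b1 b2 else 0).
    apply: eq_big_nat => c1 /andP[_ hc1]; apply: eq_big_nat => c2 /andP[_ hc2].
    apply: eq_big_nat => e /andP[_ he]; apply: eq_big_nat => b1 /andP[_ hb1].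
    apply: eq_big_nat => b2 /andP[_ hb2].
    have he2 : (e < 2)%N by apply: leq_trans he hE.
    have carry2 c b : (c < 2)%N -> (b < 2)%N -> (carry e c b < 2)%N.
      by move=> hc hb; rewrite /carry ltn_divLR //; lia.
    rewrite /source moments_idx ?carry2 //.
    case: ifP => ht; last first.
      rewrite !big1 // => x _; rewrite !big1 // => y _; rewrite !big1 // => z _.
      by case: ifP => // /and3P[/eqP ex /eqP ey /eqP ez];
        rewrite /term ex ey ez ht.
    rewrite mulr_sumr; apply: eq_bigr => x _.
    rewrite mulr_sumr; apply: eq_bigr => y _.
    rewrite mulr_sumr; apply: eq_bigr => z _.
    case: ifP => [/and3P[/eqP ex /eqP ey /eqP ez]|_]; last by rewrite mulr0.
    rewrite /term ex ey ez ht !pair_bit_digit // ex ey ez -signM.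
    by congr sign; case: (window_bit _ _ _ _ _ _ _);
      case: (window_bit _ _ _ _ _ _ _); case: (pair_bit _ _ _);
      case: (pair_bit _ _ _).
  rewrite exchange5; apply: eq_bigr => x _.
  rewrite exchange5; apply: eq_bigr => y _.
  rewrite exchange5; apply: eq_bigr => z _.
  case: ifP => // _.
  by rewrite !big1 // => ? _; rewrite !big1 // => ? _; rewrite !big1 // => ? _;
     rewrite !big1 // => ? _; rewrite !big1 // => ? _; rewrite !big1.
rewrite [RHS]hmu; apply: eq_bigr => x _.
rewrite exchange4; apply: eq_bigr => e _.
have -> : (4 * nu.*2 = (4 * nu).*2)%N by lia.
rewrite [RHS]sum_digits; apply: eq_bigr => y _.
rewrite exchange3; apply: eq_bigr => b1 _.
rewrite [RHS]sum_digits; apply: eq_bigr => z _.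
rewrite exchange2; apply: eq_bigr => b2 _.
apply: eq_bigr => c1 _; apply: eq_bigr => c2 _; rewrite /term /target.
have md u b : (((u %% K).*2 + b) %% K = (u.*2 + b) %% K)%N.
  by rewrite -!addnn -modnDml modnDm modnDml.
by rewrite !md.
Qed.

End Doubling.

Lemma start_moments K wa t : start_weight K wa t = moments K wa 1 1 t.
Proof.
rewrite /moments big_nat1 big_add1; apply: eq_bigr => n1 _.
rewrite big_add1; apply: eq_bigr => n2 _.
by do 2 (apply: eq_bigr => ? _); rewrite mod0n.
Qed.

Lemma energy_moments K wa mu nu : (0 < K)%N ->
  energy K (moments K wa mu nu) =
  \sum_(0 <= M < mu) block_sum wa nu M.+1 ^+ 2.
Proof.
move=> K0.
transitivity (\sum_(0 <= x < mu) \sum_(nu <= y < 4 * nu)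
  \sum_(nu <= z < 4 * nu)
    sign (pair_bit wa y (x + 1) (+) pair_bit wa z (x + 1))).
  rewrite -[RHS](sum_residues _ _ _ _ K0).
  apply: eq_big_nat => M /andP[_ hM]; apply: eq_big_nat => r1 /andP[_ h1].
  by apply: eq_big_nat => r2 /andP[_ h2]; rewrite moments_idx.
apply: eq_bigr => x _; rewrite expr2 /block_sum mulr_suml.
apply: eq_bigr => y _; rewrite mulr_sumr; apply: eq_bigr => z _.
by rewrite signM addn1.
Qed.

Lemma eq_push_weight K E w Y Y' : Y =1 Y' ->
  push_weight K E w Y =1 push_weight K E w Y'.
Proof.
move=> h t; rewrite /push_weight.
by do 8 (apply: eq_bigr => ? _); rewrite h.
Qed.

Lemma tested_energyE k w wa j (K := (2 ^ k)%N) :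
  (forall n b, (b < 2)%N ->
     wa (n.*2 + b)%N = wa n (+) w ((n.*2 + b) %% K.*2)%N) ->
  tested_energy K w wa k j =
  \sum_(0 <= M < 2 ^ j) block_sum wa (2 ^ (k + k + j)) M.+1 ^+ 2.
Proof.
move=> hwa; have K0 : (0 < K)%N by rewrite expn_gt0.
have h1 i : iter i (push_weight K 1 w) (start_weight K wa) =1
    moments K wa 1 (2 ^ i).
  elim: i => [|i IH] t; first exact: start_moments.
  rewrite iterS (eq_push_weight _ _ _ IH) expnS mul2n.
  by apply: push_moments => // F; rewrite !big_nat1.
have h2 : iter j (push_weight K 2 w) (iter (k + k) (push_weight K 1 w)
    (start_weight K wa)) =1 moments K wa (2 ^ j) (2 ^ (k + k + j)).
  elim: j => [|j IH] t; first by rewrite addn0 -h1.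
  rewrite iterS (eq_push_weight _ _ _ IH) addnS !expnS !mul2n.
  by apply: push_moments => // F; rewrite -sum_digits.
rewrite -(energy_moments _ _ _ K0) /tested_energy /energy.
by do 3 (apply: eq_bigr => ? _); rewrite h2.
Qed.

(** * A finite test *)

Lemma mx_recurrence_eq0 n (A : 'M[int]_n.+1) (u : 'rV[int]_n.+1)
    (y : 'cV[int]_n.+1) :
  (forall j, (j < n.+1)%N -> u *m A ^+ j *m y = 0) ->
  forall j, u *m A ^+ j *m y = 0.
Proof.
move=> h j; set p := char_poly A.
have pm : p \is monic by apply: char_poly_monic.
have -> : A ^+ j = horner_mx A (Pdiv.CommonRing.rmodp 'X^j p).
  have -> : A ^+ j = horner_mx A 'X^j by rewrite rmorphXn /= horner_mx_X.
  rewrite {1}(Pdiv.RingMonic.rdivp_eq pm 'X^j) rmorphD rmorphM /=.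
  by rewrite Cayley_Hamilton mulr0 add0r.
set r := Pdiv.CommonRing.rmodp _ _.
have hr : (size r <= n.+1)%N.
  by rewrite -ltnS -(size_char_poly A) Pdiv.CommonRing.ltn_rmodpN0 ?monic_neq0.
rewrite -[r]coefK poly_def raddf_sum /= mulmx_sumr mulmx_suml.
apply: big1 => i _; rewrite linearZ /= rmorphXn /= horner_mx_X.
by rewrite -scalemxAr -scalemxAl h ?scaler0 // (leq_trans _ hr).
Qed.

Lemma recurrence_eq0 n (F : (nat -> int) -> nat -> int) (G : (nat -> int) -> int)
    (a : nat -> nat -> int) (g : nat -> int) (Y : nat -> int) :
  (0 < n)%N ->
  (forall Z t, F Z t = \sum_(0 <= s < n) a t s * Z s) ->
  (forall Z, G Z = \sum_(0 <= s < n) g s * Z s) ->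
  (forall j, (j < n)%N -> G (iter j F Y) = 0) -> forall j, G (iter j F Y) = 0.
Proof.
case: n => // n _ hF hG h j.
pose A : 'M[int]_n.+1 := \matrix_(t, s) a t s.
pose u : 'rV[int]_n.+1 := \row_s g s.
pose y : 'cV[int]_n.+1 := \col_s Y s.
have hA i : A ^+ i *m y = \col_s iter i F Y s.
  elim: i => [|i IH]; first by rewrite expr0 mul1mx.
  rewrite exprS -mulmxE -mulmxA IH; apply/matrixP => t z.
  by rewrite !mxE /= hF big_mkord; apply: eq_bigr => s _; rewrite !mxE.
have hu i : G (iter i F Y) = (u *m A ^+ i *m y) 0 0.
  rewrite -mulmxA hA mxE hG big_mkord; apply: eq_bigr => s _.
  by rewrite !mxE.
rewrite hu mx_recurrence_eq0 ?mxE // => i hi.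
apply/matrixP => x z; rewrite !ord1 -hu mxE; exact: h.
Qed.

Lemma sum_delta n (x : nat) (Z : nat -> int) : (x < n)%N ->
  Z x = \sum_(0 <= s < n) (x == s)%:R * Z s.
Proof.
move=> hx; rewrite -[LHS](@sum_pick n x) //; apply: eq_bigr => s _.
by case: eqP => [->|_]; rewrite ?mul1r ?mul0r.
Qed.

(** The matrix entries are the images of unit vectors; every [source] lies below 4 K ^ 3, so no
    other value of Y enters. *)
Lemma push_weight_linear K E w Y t : (0 < K)%N -> (E <= 2)%N ->
  push_weight K E w Y t =
  \sum_(0 <= s < 4 * K ^ 3)
    push_weight K E w (fun x => (x == s)%:R) t * Y s.
Proof.
move=> K0 hE.
transitivity (push_weight K E w
    (fun x => \sum_(0 <= s < 4 * K ^ 3) (x == s)%:R * Y s) t).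
  apply: eq_big_nat => M /andP[_ hM]; apply: eq_big_nat => r1 /andP[_ h1].
  apply: eq_big_nat => r2 /andP[_ h2]; apply: eq_big_nat => c1 /andP[_ hc1].
  apply: eq_big_nat => c2 /andP[_ hc2]; apply: eq_big_nat => e /andP[_ he].
  apply: eq_big_nat => b1 /andP[_ hb1]; apply: eq_big_nat => b2 /andP[_ hb2].
  case: ifP => // _; congr (_ * _); apply: sum_delta; apply: idx_lt => //.
    by rewrite /carry ltn_divLR //; lia.
  by rewrite /carry ltn_divLR //; lia.
transitivity (\sum_(0 <= s < 4 * K ^ 3)
    push_weight K E w (fun x => (x == s)%:R * Y s) t).
  do 8 (rewrite [RHS]exchange_big; apply: eq_bigr => ? _).
  by case: ifP => _; rewrite ?mulr_sumr // big1.
apply: eq_bigr => s _.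
do 8 (rewrite mulr_suml; apply: eq_bigr => ? _).
by case: ifP => _; rewrite ?mulrA ?mul0r.
Qed.

Lemma energy_linear K Y : (0 < K)%N ->
  energy K Y =
  \sum_(0 <= s < 4 * K ^ 3) energy K (fun x => (x == s)%:R) * Y s.
Proof.
move=> K0.
transitivity (energy K (fun x => \sum_(0 <= s < 4 * K ^ 3) (x == s)%:R * Y s)).
  apply: eq_big_nat => M /andP[_ hM]; apply: eq_big_nat => r1 /andP[_ h1].
  apply: eq_big_nat => r2 /andP[_ h2]; apply: sum_delta; exact: idx_lt.
transitivity (\sum_(0 <= s < 4 * K ^ 3) energy K (fun x => (x == s)%:R * Y s)).
  by do 3 (rewrite [RHS]exchange_big; apply: eq_bigr => ? _).
by apply: eq_bigr => s _; do 3 (rewrite mulr_suml; apply: eq_bigr => ? _).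
Qed.

Lemma block_sum_le wa nu m : `|block_sum wa nu m| <= (3 * nu)%N%:Z.
Proof.
apply: le_trans (ler_norm_sum _ _ _) _.
rewrite (eq_bigr (fun=> 1)) => [|n _]; last by rewrite /sign normr_sign.
rewrite big_const_nat iter_addr_0 pmulrn intz lez_nat; lia.
Qed.

Lemma tested_energy_ge0 k w wa j (K := (2 ^ k)%N) :
  (forall n b, (b < 2)%N ->
     wa (n.*2 + b)%N = wa n (+) w ((n.*2 + b) %% K.*2)%N) ->
  0 <= tested_energy K w wa k j.
Proof.
by move=> hwa; rewrite tested_energyE //; apply: sumr_ge0 => M _; apply: sqr_ge0.
Qed.

Lemma tested_energy_lt k w wa j (K := (2 ^ k)%N) :
  (forall n b, (b < 2)%N ->
     wa (n.*2 + b)%N = wa n (+) w ((n.*2 + b) %% K.*2)%N) ->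
  (j < 4 * K ^ 3)%N ->
  tested_energy K w wa k j < (2 ^ (16 * K ^ 3))%N%:Z.
Proof.
move=> hwa hj; rewrite tested_energyE //.
set nu := (2 ^ (k + k + j))%N.
apply: le_lt_trans (_ : (2 ^ j * (3 * nu) ^ 2)%N%:Z < _).
  apply: le_trans (ler_sum _ (_ : forall M, true -> _ <= (3 * nu)%N%:Z ^+ 2)) _.
    move=> M _; rewrite -real_normK ?num_real // ler_sqr ?nnegrE //.
    exact: block_sum_le.
  by rewrite big_const_nat iter_addr_0 subn0 -mulr_natl -!natz !(natrM, natrX).
(* Each of the 2 ^ j squares is at most (3 nu) ^ 2 <= 2 ^ (4 k + 2 j + 4). Then j < 4 K ^ 3 and k <
   K <= K ^ 3 bring the exponent below 16 K ^ 3. *)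
rewrite ltz_nat; apply: leq_ltn_trans (_ : 2 ^ (4 + 4 * k + 3 * j) < _)%N.
  apply: (@leq_trans (2 ^ j * (4 * nu) ^ 2)); first by rewrite leq_mul2l leq_exp2r ?leq_mul2r ?orbT.
  have -> : (4 * nu = 2 ^ (k + k + j).+2)%N by rewrite !expnS /nu; lia.
  by rewrite -expnM -expnD leq_exp2l //; lia.
rewrite ltn_exp2l //.
have hk : (k < K)%N by apply: ltn_expl.
have hK : (K <= K ^ 3)%N by rewrite -{1}(expn1 K) leq_pexp2l // expn_gt0.
by lia.
Qed.

Lemma rejectedP k w wa (K := (2 ^ k)%N) :
  (forall n b, (b < 2)%N ->
     wa (n.*2 + b)%N = wa n (+) w ((n.*2 + b) %% K.*2)%N) ->
  reflect (forall j, tested_energy K w wa k j = 0) (~~ rejected K w wa k).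
Proof.
move=> hwa; have K0 : (0 < K)%N by rewrite expn_gt0.
have n0 : (0 < 4 * K ^ 3)%N by rewrite muln_gt0 expn_gt0 K0.
apply: (iffP idP) => [hr|h0]; last first.
  by apply/hasPn => i _; apply/hasPn => j _; rewrite negbK h0 dvdz0.
apply: (recurrence_eq0 n0).
- by move=> Z t; apply: push_weight_linear.
- by move=> Z; apply: energy_linear.
move=> j hj; rewrite -/(tested_energy K w wa k j).
have := tested_energy_ge0 j hwa; have := tested_energy_lt hwa hj.
rewrite -/K; case E : (tested_energy K w wa k j) => [d|//] hlt _.
have {hlt} hlt : (d < 2 ^ (16 * K ^ 3))%N by rewrite -ltz_nat.
apply/eqP/negPn/negP; rewrite eqz_nat -lt0n => d0.
suff : (2 ^ (16 * K ^ 3).+1.-1 <= d)%N by rewrite leqNgt hlt.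
apply: leq_common_multiple => // q /andP[q0 hq].
(* The divisor 1 is trivial, and [q.+2] is the modulus of round q of the program. *)
case: q q0 hq => [|[|q]] // _ hq.
move/hasPn: hr => /(_ q); rewrite mem_iota /= add0n => /(_ hq).
move/hasPn => /(_ j); rewrite mem_iota /= add0n => /(_ hj).
by rewrite negbK E addn2 /dvdz /=.
Qed.

(** * Correlations over dyadic blocks *)


Definition corr_sum (wa : nat -> bool) (m X : nat) : int :=
  \sum_(0 <= n < X) sign (pair_bit wa n m).

(** The correlation sum is o(X), with an integer c in place of 1 / epsilon so that the combinatorial
    part stays within the integers. *)
Definition sublinear (wa : nat -> bool) (m : nat) : Prop :=
  forall c : nat, exists X0, forall X, (X0 <= X)%N ->
    c%:Z * `|corr_sum wa m X| <= X%:Z.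

Lemma sum_blocks a b (F : nat -> int) :
  \sum_(0 <= n < a * b) F n =
  \sum_(0 <= c < a) \sum_(0 <= u < b) F (c * b + u)%N.
Proof.
elim: a => [|a IH]; first by rewrite mul0n !big_geq.
rewrite big_nat_recr //= -IH (big_cat_nat (n := a * b)) //=; last first.
  by rewrite leq_mul2r leqnSn orbT.
congr (_ + _); rewrite -{1}[(a * b)%N]add0n big_addn mulSn addnK.
by apply: eq_bigr => u _; rewrite addnC.
Qed.

Lemma block_sumE wa nu m :
  block_sum wa nu m = corr_sum wa m (4 * nu) - corr_sum wa m nu.
Proof.
rewrite /corr_sum (big_cat_nat (n := nu) (p := (4 * nu)%N)) //=; last by lia.
by rewrite addrAC subrr add0r.
Qed.

Section Blocks.
Variables (k : nat) (w wa : nat -> bool).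
Let K := (2 ^ k)%N.
Hypothesis wa_digit : forall n b, (b < 2)%N ->
  wa (n.*2 + b)%N = wa n (+) w ((n.*2 + b) %% K.*2)%N.

Let K0 : (0 < K)%N. Proof. by rewrite expn_gt0. Qed.

Definition class_sum (N m r : nat) : int :=
  \sum_(0 <= n < 2 ^ N) (if (n %% K == r)%N then sign (pair_bit wa n m) else 0).

Definition transfer (m : nat) (Z : nat -> nat -> int) (r : nat) : int :=
  \sum_(0 <= y < K) \sum_(0 <= b < 2)
    (if ((y.*2 + b) %% K == r)%N
     then sign (window_bit w K (m %/ 2 %% K) y (m %% 2) 0 b)
          * Z ((m + b) %/ 2)%N y else 0).

Lemma class_sumS N m r : class_sum N.+1 m r = transfer m (class_sum N) r.
Proof.
rewrite /class_sum expnS mul2n -[0%N]/(0.*2) sum_digits /transfer.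
transitivity (\sum_(0 <= y < K) \sum_(0 <= n < 2 ^ N) if (n %% K == y)%N then
    \sum_(0 <= b < 2) (if ((y.*2 + b) %% K == r)%N
     then sign (window_bit w K (m %/ 2 %% K) y (m %% 2) 0 b) *
          sign (pair_bit wa n ((m + b) %/ 2)) else 0) else 0).
  rewrite [RHS]exchange_big /=; apply: eq_bigr => n _.
  rewrite -[LHS](@sum_pick K (n %% K)) ?ltn_mod //; apply: eq_bigr => y _.
  case: eqP => // <-; apply: eq_big_nat => b /andP[_ hb].
  have -> : (((n %% K).*2 + b) %% K = (n.*2 + b) %% K)%N.
    by rewrite -!addnn -modnDml modnDm modnDml.
  case: ifP => // _; rewrite -signM {1}(divn_eq m 2) muln2 -[(_ + m %% 2)%N]addn0.
  rewrite (pair_bit_digit K0 wa_digit) ?ltn_mod // /carry addn0.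
  congr (sign (_ (+) pair_bit wa n _)).
  by rewrite {3}(divn_eq m 2) -addnA divnMDl.
apply: eq_bigr => y _.
transitivity (\sum_(0 <= b < 2) \sum_(0 <= n < 2 ^ N)
   if ((y.*2 + b) %% K == r)%N then
     sign (window_bit w K (m %/ 2 %% K) y (m %% 2) 0 b) *
     (if (n %% K == y)%N then sign (pair_bit wa n ((m + b) %/ 2)) else 0) else 0).
  rewrite [RHS]exchange_big /=; apply: eq_bigr => n _.
  case: ifP => _; apply/esym; last first.
    by rewrite big1 // => b _; rewrite mulr0 if_same.
  by [].
by apply: eq_bigr => b _; case: ifP => _; rewrite ?mulr_sumr // big1.
Qed.

Lemma transfer_sub m (Z Z' : nat -> nat -> int) c r :
  transfer m (fun m r => Z m r - c * Z' m r) r =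
  transfer m Z r - c * transfer m Z' r.
Proof.
rewrite /transfer mulr_sumr -sumrB; apply: eq_bigr => y _.
rewrite mulr_sumr -sumrB; apply: eq_bigr => b _.
by case: ifP => _; rewrite ?mulr0 ?subr0 // mulrBr mulrCA.
Qed.

Definition defect (N m r : nat) : int := class_sum N.+1 m r - 2 * class_sum N m r.

Lemma defectS N m r : defect N.+1 m r = transfer m (defect N) r.
Proof. by rewrite /defect transfer_sub -!class_sumS. Qed.

(** For shift 0 all terms are 1, and from N = k on every class mod K doubles its size. *)
Lemma defect_shift0 N r : (k <= N)%N -> defect N 0 r = 0.
Proof.
move=> kN; rewrite /defect /class_sum.
rewrite (big_cat_nat (n := (2 ^ N)%N)) ?leq_exp2l //= -{2}[(2 ^ N)%N]add0n.
rewrite big_addn expnS mul2n -addnn addnK.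
set s := \sum_(0 <= n < 2 ^ N) _; set s' := \sum_(0 <= n < 2 ^ N) _.
suff -> : s' = s by ring.
apply: eq_bigr => n _; rewrite /pair_bit !addn0 !addbb.
by rewrite -(subnKC kN) expnD -modnDmr modnMr addn0.
Qed.

(** From shift 1 the digit 0 leads to shift 0, where the defect vanishes. Only the digit 1 remains;
    it sends the class y to 2 y + 1, so r + 1 gains a factor 2 at each step. *)
Lemma defect_shift1 N t r : (t <= k)%N -> (k + t <= N)%N -> (r < K)%N ->
  ~~ (2 ^ t %| r.+1)%N -> defect N 1 r = 0.
Proof.
elim: t N r => [|t IH] N r tk tN rK hr; first by rewrite dvd1n in hr.
case: N tN => [|N] tN; first by lia.
rewrite defectS; apply: big1_seq => y; rewrite mem_index_iota => /andP[_ hy].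
rewrite unlock /= !addn0 addr0 (_ : (1 + 1) %/ 2 = 1)%N //.
rewrite defect_shift0 ?mulr0 ?if_same ?add0r; last by lia.
case: ifP => // /eqP h; rewrite IH ?mulr0 //; [by lia|by lia|].
apply: contra hr => hy1; rewrite -h.
have dK : (2 ^ t.+1 %| K)%N by rewrite dvdn_exp2l.
rewrite -(dvdn_addr _ (dvdn_mull ((y.*2 + 1) %/ K) dK)) addnS -divn_eq.
by rewrite addn1 -doubleS -mul2n expnS dvdn_pmul2l.
Qed.

(** At shift 1 only the class K - 1 survives; one step multiplies its defect by a fixed sign, so two
    steps preserve it. Larger shifts are halved until they are at most 1. *)
Lemma defect_period N m r j : (m <= 2 ^ j)%N -> (k + k + j <= N)%N ->
  (r < K)%N -> defect N.+2 m r = defect N m r.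
Proof.
elim: j N m r => [|j IH] N m r hm hN hr; last first.
  case: N hN => [|N] hN; first by lia.
  rewrite 2!defectS; apply: eq_big_nat => y /andP[_ hy].
  apply: eq_big_nat => b /andP[_ hb]; case: ifP => // _; congr (_ * _).
  by apply: IH => //; move: hm; rewrite ?expnS; lia.
case: m hm => [|[|m]] hm //; first by rewrite !defect_shift0 //; lia.
have [hd|hd] := boolP (2 ^ k %| r.+1)%N; last first.
  by rewrite !(@defect_shift1 _ k) //; lia.
have {hd hr} -> : r = K.-1.
  have := dvdn_leq (ltn0Sn r) hd; rewrite -/K; lia.
pose s : int := sign (window_bit w K (1 %/ 2 %% K) K.-1 (1 %% 2) 0 1).
have step N' : (k + k <= N')%N -> defect N'.+1 1 K.-1 = s * defect N' 1 K.-1.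
  move=> hN'; rewrite defectS /transfer.
  rewrite (eq_big_nat _ _ (F2 := fun y =>
    if K.-1 == y then s * defect N' 1 K.-1 else 0)) ?sum_pick ?prednK //.
  move=> y /andP[_ hy]; rewrite unlock /= !addn0 addr0.
  rewrite (_ : 1 %/ 2 = 0)%N // (_ : (1 + 1) %/ 2 = 1)%N //.
  rewrite defect_shift0 ?mulr0 ?if_same ?add0r; last by lia.
  have [<-|ne] := eqVneq K.-1 y.
    rewrite (_ : (K.-1.*2 + 1) %% K = K.-1)%N ?eqxx //.
    rewrite (_ : (K.-1.*2 + 1 = 1 * K + K.-1)%N); last by lia.
    by rewrite modnMDl modn_small // prednK.
  rewrite (@defect_shift1 N' k y) ?mulr0 ?if_same //.
  by apply/negP => /dvdnP[[|[|u]]]; move/eqP: ne; rewrite -/K; nia.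
rewrite !step; try lia.
by rewrite mulrA /s /sign -signr_addb addbb mul1r.
Qed.

Lemma corr_sum_classes N m :
  corr_sum wa m (2 ^ N) = \sum_(0 <= r < K) class_sum N m r.
Proof.
rewrite /class_sum exchange_big /=; apply: eq_bigr => n _.
by rewrite sum_pick // ltn_mod.
Qed.

(* The vectors of class sums follow a linear recursion whose eigenvalues other
   than 2 are 0 and a sign; subtracting the sum up to 2 ^ N from the one up to
   2 ^ (N + 2) removes the sign and leaves an eigenvector for 2. *)
Lemma block_sum_double N m j : (m <= 2 ^ j)%N -> (k + k + j <= N)%N ->
  block_sum wa (2 ^ N.+1) m = 2 * block_sum wa (2 ^ N) m.
Proof.
move=> hm hN; rewrite !block_sumE -[4%N]/(2 ^ 2)%N -!expnD !add2n.
rewrite !corr_sum_classes; apply/eqP; rewrite -subr_eq0; apply/eqP.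
transitivity (\sum_(0 <= r < K) (defect N.+2 m r - defect N m r)).
  rewrite /defect !sumrB -!mulr_sumr; ring.
apply: big1_seq => r; rewrite mem_index_iota => /andP[_ hr].
by rewrite (defect_period hm hN) ?subrr.
Qed.

(** Windows ending above the last i digits are common to n and p and cancel; the remaining ones lie
    within the last i + k digits. *)
Lemma pair_stable i n p n' p' :
  n = n' %[mod 2 ^ (i + k)] -> p = p' %[mod 2 ^ (i + k)] ->
  (n %/ 2 ^ i = p %/ 2 ^ i)%N -> (n' %/ 2 ^ i = p' %/ 2 ^ i)%N ->
  wa n (+) wa p = wa n' (+) wa p'.
Proof.
elim: i n p n' p' => [|i IH] n p n' p'.
  by rewrite !divn1 => _ _ -> ->; rewrite !addbb.
have half a a' : a = a' %[mod 2 ^ (i.+1 + k)] ->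
    (a %/ 2 = a' %/ 2 %[mod 2 ^ (i + k)])%N.
  by move=> e; rewrite !modn_divl -expnSr -addSn e.
have waE a : wa a = wa (a %/ 2)%N (+) w (a %% K.*2)%N.
  by rewrite {1}(divn_eq a 2) muln2 wa_digit ?ltn_mod // -muln2 -divn_eq.
have wE a a' : a = a' %[mod 2 ^ (i.+1 + k)] -> (a %% K.*2 = a' %% K.*2)%N.
  have d : (K.*2 %| 2 ^ (i.+1 + k))%N.
    by rewrite -mul2n -expnS dvdn_exp2l // addSn ltnS leq_addl.
  by move=> e; rewrite -(modn_dvdm a d) e modn_dvdm.
move=> en ep; rewrite !expnS !divnMA => e e'.
have := IH _ _ _ _ (half _ _ en) (half _ _ ep) e e'.
rewrite (waE n) (waE p) (waE n') (waE p') (wE _ _ en) (wE _ _ ep).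
case: (wa (n %/ 2)); case: (wa (p %/ 2)); case: (wa (n' %/ 2));
  case: (wa (p' %/ 2)) => // _; by case: (w _); case: (w _).
Qed.

Definition translate_sum (m N y : nat) : int :=
  \sum_(0 <= x < 2 ^ N) sign (pair_bit wa (y * 2 ^ N + x) m).

(* By [pair_stable] the translate matters only for those x for which adding m
   produces a carry out of the last i digits. *)
Lemma translate_sum_close m i y :
  `|translate_sum m (i + k) y - translate_sum m (i + k) 0| <=
  (2 * (m * K))%N%:Z.
Proof.
rewrite /translate_sum -sumrB; apply: le_trans (ler_norm_sum _ _ _) _.
rewrite addnC expnD sum_blocks.
(* The x are split into K runs of length 2 ^ i. In each run at most m values produce the carry, and
   each changes the sum by at most 2. *)
apply: (@le_trans _ _ (\sum_(0 <= c < K) (2 * m)%N%:Z)); last first.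
  by rewrite big_const_nat iter_addr_0 subn0 -mulr_natl natz -PoszM lez_nat; lia.
apply: ler_sum_nat => c /andP[_ hc].
apply: (@le_trans _ _ (\sum_(0 <= u < 2 ^ i)
    (if (u < 2 ^ i - m)%N then 0 else 2 : int))); last first.
  have [hm|hm] := leqP m (2 ^ i); last first.
    rewrite (eq_bigr (fun=> 2%:Z)) => [|u _]; last by rewrite ifN //; lia.
    by rewrite big_const_nat iter_addr_0 subn0 -mulr_natl natz -PoszM lez_nat; lia.
  rewrite (big_cat_nat (n := (2 ^ i - m)%N)) ?leq_subr //=.
  rewrite big_nat_cond big1 ?add0r => [|u]; last by case/andP=> /andP[_ ->].
  rewrite (eq_big_nat _ _ (F2 := fun=> 2%:Z)) => [|u]; last first.
    by case/andP=> h _; rewrite ifN // -leqNgt.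
  by rewrite big_const_nat iter_addr_0 subKn // -mulr_natl natz -PoszM mulnC.
apply: ler_sum_nat => u /andP[_ hu]; case: ifP => [h|_]; last first.
  by case: (pair_bit _ _ _); case: (pair_bit _ _ _).
suff -> : pair_bit wa (y * (2 ^ k * 2 ^ i) + (c * 2 ^ i + u)) m =
    pair_bit wa (0 * (2 ^ k * 2 ^ i) + (c * 2 ^ i + u)) m by rewrite subrr normr0.
have e : (2 ^ (i + k) = 2 ^ k * 2 ^ i)%N by rewrite addnC expnD.
rewrite mul0n add0n /pair_bit; apply: (@pair_stable i).
- by rewrite e modnMDl.
- by rewrite e -addnA modnMDl.
- by rewrite mulnA -!addnA addnA -mulnDl !divnMDl ?expn_gt0 // !divn_small //; lia.
- by rewrite -addnA !divnMDl ?expn_gt0 // !divn_small //; lia.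
Qed.

End Blocks.

(** * The criterion *)

Section Criterion.
Variables (k : nat) (w wa : nat -> bool).
Let K := (2 ^ k)%N.
Hypothesis wa_digit : forall n b, (b < 2)%N ->
  wa (n.*2 + b)%N = wa n (+) w ((n.*2 + b) %% K.*2)%N.

Lemma tested_energy_eq0P :
  (forall j, tested_energy K w wa k j = 0) <->
  (forall j m, (0 < m <= 2 ^ j)%N -> block_sum wa (2 ^ (k + k + j)) m = 0).
Proof.
split=> [h j m /andP[m0 hm]|h j]; last first.
  rewrite tested_energyE // big1_seq // => M; rewrite mem_index_iota => /andP[_ hM].
  by rewrite h ?expr0n //= ltnS.
have := h j; rewrite tested_energyE // big_mkord => /eqP.
rewrite psumr_eq0 => [|M _]; last exact: sqr_ge0.
have hm' : (m.-1 < 2 ^ j)%N by rewrite prednK.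
move/allP/(_ (Ordinal hm')); rewrite mem_index_enum => /(_ isT) /=.
by rewrite prednK // sqrf_eq0 => /eqP.
Qed.

Lemma block_sum_iter i N m j : (m <= 2 ^ j)%N -> (k + k + j <= N)%N ->
  block_sum wa (2 ^ (N + i)) m = 2 ^+ i * block_sum wa (2 ^ N) m.
Proof.
move=> hm hN; elim: i => [|i IH]; first by rewrite addn0 mul1r.
rewrite addnS (block_sum_double wa_digit hm) ?IH ?exprS ?mulrA //.
exact: leq_trans (leq_addr _ _).
Qed.

(** A nonzero block sum h doubles with N and so grows linearly. The block sum is a difference of
    sums up to 4 X and X, whence c |h| <= 5 * 2 ^ N; the constant c is chosen just above the
    right-hand side. *)
Lemma sublinear_block_sum m j : (m <= 2 ^ j)%N -> sublinear wa m ->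
  block_sum wa (2 ^ (k + k + j)) m = 0.
Proof.
move=> hm hs; set N := (k + k + j)%N; set h := block_sum _ _ _.
have [X0 hX0] := hs (5 * 2 ^ N).+1; set c := (5 * 2 ^ N).+1 in hX0.
have hX1 : (X0 <= 2 ^ (N + X0))%N.
  by apply: leq_trans (ltnW (ltn_expl X0 (ltnSn 1))) _; rewrite leq_exp2l ?leq_addl.
have e := block_sum_iter X0 hm (leqnn N); rewrite -/h block_sumE in e.
have h1 := hX0 _ hX1.
have h2 := hX0 _ (leq_trans hX1 (leq_pmull (2 ^ (N + X0)) (isT : 0 < 4)%N)).
have h3 : c%:Z * (2 ^+ X0 * `|h|) <= 5 * (2 ^+ N * 2 ^+ X0).
  rewrite -{1}[2 ^+ X0]ger0_norm ?exprn_ge0 // -normrM -e.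
  apply: (@le_trans _ _ ((4 * 2 ^ (N + X0))%N%:Z + (2 ^ (N + X0))%N%:Z)).
    apply: le_trans (lerD h2 h1); rewrite -mulrDr ler_wpM2l // ler_normB.
    by [].
  by rewrite -!natz !(natrM, natrX) exprD; lra.
have p0 : (0 : int) < 2 ^+ X0 by rewrite exprn_gt0.
rewrite mulrCA [X in _ <= X]mulrA [X in _ <= X]mulrC ler_pM2l // in h3.
apply/eqP; rewrite -normr_le0; move: h3.
have -> : 5 * 2 ^+ N = (c%:Z - 1)%R.
  by rewrite /c -[(5 * 2 ^ N).+1%N]addn1 PoszD addrK -!natz natrM natrX.
have : 0 <= `|h| by [].
have : 1 <= c%:Z by rewrite lez_nat.
move: `|h| c%:Z => x y; case: (lerP x 0) => // x0; nia.
Qed.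

Lemma corr_sum_translates N q m :
  corr_sum wa m (q * 2 ^ N) = \sum_(0 <= y < q) translate_sum wa m N y.
Proof. exact: sum_blocks. Qed.

(** The vanishing block consists of the translates 1, 2, 3, each within B of translate 0, so
    translate 0 is at most B and every translate at most 2 B. As B does not depend on N, cutting [0,
    X) into long translates gives o(X). *)
Lemma sublinear_of_block_sum m N0 : (forall N, (N0 <= N)%N ->
  block_sum wa (2 ^ N) m = 0) -> sublinear wa m.
Proof.
move=> h c; pose B := (2 * (m * K))%N.
pose i := (N0 + 8 * B * c)%N; pose N := (i + k)%N.
have tB y : `|translate_sum wa m N y| <= (2 * B)%N%:Z.
  have cl z := translate_sum_close wa_digit m i z.
  have e1 := corr_sum_translates N 1 m; rewrite mul1n in e1.
  have := h N; rewrite block_sumE e1 corr_sum_translates.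
  rewrite unlock /= !addr0 => h0.
  have {h0} := h0 (leq_trans (leq_addr _ _) (leq_addr _ _)).
  have := cl 1%N; have := cl 2%N; have := cl 3%N; have := cl y.
  rewrite -/N -/K -/B.
  move: (translate_sum _ _ _ 0) (translate_sum _ _ _ 1) (translate_sum _ _ _ 2)
    (translate_sum _ _ _ 3) (translate_sum _ _ _ y) => a0 a1 a2 a3 ay.
  lia.
exists (2 * c * 2 ^ N)%N => X hX.
have hq := divn_eq X (2 ^ N); set q := (X %/ _)%N in hq.
have hc : `|corr_sum wa m X| <= (q * (2 * B) + 2 ^ N)%N%:Z.
  rewrite /corr_sum (big_cat_nat (n := (q * 2 ^ N)%N)) //=; last first.
    by rewrite hq leq_addr.
  apply: le_trans (ler_normD _ _) _; rewrite PoszD lerD //.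
    rewrite -/(corr_sum wa m (q * 2 ^ N)) corr_sum_translates.
    apply: le_trans (ler_norm_sum _ _ _) _.
    apply: le_trans (ler_sum _ (fun y _ => tB y)) _.
    by rewrite big_const_nat iter_addr_0 subn0 -mulr_natl natz -PoszM.
  apply: le_trans (ler_norm_sum _ _ _) _.
  rewrite (eq_bigr (fun=> 1)) => [|n _]; last by rewrite /sign normr_sign.
  rewrite big_const_nat iter_addr_0 pmulrn intz lez_nat.
  have := ltn_pmod X (expn_gt0 2 N); lia.
apply: le_trans (ler_wpM2l _ hc) _ => //.
rewrite -PoszM lez_nat.
have hN : (8 * B * c <= 2 ^ N)%N.
  apply: leq_trans (ltnW (ltn_expl _ (ltnSn 1))) _.
  by rewrite leq_exp2l // /N /i; lia.
have hqX : (q * 2 ^ N <= X)%N by rewrite hq leq_addr.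
move: (2 ^ N)%N hN hqX hX => p; nia.
Qed.

Lemma tested_energy_sublinear :
  (forall j, tested_energy K w wa k j = 0) <->
  (forall m, (0 < m)%N -> sublinear wa m).
Proof.
rewrite tested_energy_eq0P; split=> [h m m0|h j m /andP[m0 hm]]; last first.
  exact: sublinear_block_sum (h m m0).
have hm : (m <= 2 ^ m)%N := ltnW (ltn_expl m (ltnSn 1)).
apply: (@sublinear_of_block_sum _ (k + k + m)) => N hN.
rewrite -(subnKC hN) (block_sum_iter _ hm) // h ?mulr0 //.
by rewrite m0.
Qed.

End Criterion.

(** * From integer sums to limits of complex averages *)

Section Averages.
Variables (C : numClosedFieldType) (wa : nat -> bool) (a : nat -> C).
Hypothesis arch : forall e : C, 0 < e -> exists n : nat, n.+1%:R^-1 < e.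
Hypothesis aE : forall n, a n = (sign (wa n))%:~R.

Lemma correlation_averageE m X :
  correlation_average a m X = X%:R^-1 * (corr_sum wa m X)%:~R.
Proof.
rewrite /correlation_average /corr_sum rmorph_sum /=; congr (_ * _).
apply: eq_bigr => n _; rewrite !aE rmorph_int -intrM.
by rewrite -signM.
Qed.

Lemma norm_correlation_average_lt m X c : (0 < X)%N ->
  (`|correlation_average a m X| < c.+1%:R^-1) =
  (c.+1%:Z * `|corr_sum wa m X| < X%:Z).
Proof.
move=> X0; rewrite correlation_averageE normrM normfV normr_nat -intr_norm.
rewrite mulrC ltr_pdivrMr ?ltr0n // mulrC ltr_pdivlMr ?ltr0n //.
by rewrite mulrC -[c.+1%:R]/(c.+1%:Z%:~R) -[X%:R]/(X%:Z%:~R) -intrM ltr_int.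
Qed.

Lemma noncorrelatedP :
  noncorrelated a <-> (forall m, (0 < m)%N -> sublinear wa m).
Proof.
split=> [h m m0 c|h m m0].
  have [h1 h2] := h m m0.
  have {h1 h2} h0 : (correlation_average a m @ \oo --> (0 : C))%classic.
    by rewrite -h2.
  have e0 : 0 < c.+1%:R^-1 :> C by rewrite invr_gt0 ltr0n.
  move/cvgrPdist_lt: h0 => /(_ _ e0) [N _ hN].
  exists N.+1 => X hX; have := hN X (ltnW hX).
  rewrite /= sub0r normrN norm_correlation_average_lt; last first.
    exact: leq_trans hX.
  by move/ltW; apply: le_trans; rewrite ler_wpM2r // lez_nat.
have h0 : (correlation_average a m @ \oo --> (0 : C))%classic.
  apply/cvgrPdist_lt => e e0; have [c hc] := arch e0.
  (* One more than [c.+1], because [sublinear] gives a weak inequality and a strict one is needed;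
     if the sum is 0, strictness comes from X > 0. *)
  have [X0 hX0] := h m m0 c.+2; exists X0.+1 => // X hX /=.
  rewrite sub0r normrN; apply: lt_trans hc.
  rewrite norm_correlation_average_lt; last exact: leq_trans hX.
  move: (hX0 X (ltnW hX)) (normr_ge0 (corr_sum wa m X)).
  move: `|_| => s; rewrite -[c.+2]addn1 PoszD mulrDl mul1r.
  have [->|s0] := eqVneq s 0; first by rewrite mulr0 ltz_nat (leq_trans _ hX).
  by move: (_ * s) => p; lia.
split; first by apply/cvg_ex; exists 0.
by rewrite /correlation; apply/cvg_lim.
Qed.

End Averages.

Lemma complex_archimedean (R : realType) (e : R[i]) :
  0 < e -> exists n : nat, n.+1%:R^-1 < e.
Proof.
rewrite ltcE /= => /andP[/eqP im0 re0]; exists (Num.bound (complex.Re e)^-1).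
have -> : e = (complex.Re e)%:C%C by case: e im0 {re0} => x y /= ->.
rewrite -(rmorph_nat (real_complex R)) -fmorphV ltcR.
rewrite invf_plt ?posrE ?ltr0n //.
apply: lt_trans (archi_boundP _) _; first by rewrite invr_ge0 ltW.
by rewrite ltr_nat.
Qed.

Lemma pattern_seqE (R : realType) (l : nat) (A : {set l.-tuple bool}) n :
  pattern_seq R A n = (sign (pattern_parity A n))%:~R.
Proof. by rewrite /sign rmorph_sign signr_odd. Qed.

Theorem theoremB :
  exists (p : program) (c : nat),
    forall (R : realType) (l : nat) (A : {set l.-tuple bool}),
      (1 <= l)%N ->
      nseq_tuple l false \notin A ->
      exists (t : nat) (s : state),
        exec p (input_state A) t s /\
        (t <= 2 ^ (c * l))%N /\
        answers s (noncorrelated (pattern_seq R A)).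
Proof.
have [c hc] := decision_programP.
exists decision_program, c => R l A l0 A0.
have hd n b := @pattern_parity_digit l A n b l0 A0.
have [t [s [h1 h2 h3]]] := hc l A _ l0 A0 (pattern_parity0 A l0) hd.
exists t, s; split=> //; split=> //.
have hK : (2 ^ l = (2 ^ l.-1).*2)%N by rewrite -{1}(prednK l0) expnS mul2n.
rewrite hK in hd.
have eq : noncorrelated (pattern_seq R A) <->
    ~~ rejected (2 ^ l.-1) (member A) (pattern_parity A) l.-1.
  apply: (iff_trans _ (rwP (rejectedP hd))).
  apply: (iff_trans _ (iff_sym (tested_energy_sublinear hd))).
  by apply: noncorrelatedP; [apply: complex_archimedean|apply: pattern_seqE].
rewrite /answers h3; case: (~~ _) eq => eq; [left|right]; split=> //.
  exact/eq.
by move/eq.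
Qed.
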